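(* Let $\lambda\in\mathbb Z_{>0}$, $\mathfrak m\in\mathbb Z_{\ge0}$ and $\vec\Lambda\in\mathcal Z^n[2\mathfrak m]$. Then for any $x\in\mathbb C$ (not a pole of the functions involved) $${}'\mathcal F(\lambda,x;\vec\Lambda)=\mathcal F(\lambda,x;\vec\Lambda)-\mathbb S\,\mathcal F(\lambda,x;\vec\Lambda)$$ as linear maps on $L_{\vec\Lambda}[0]$; explicitly, for all $\vec m,\vec m'\in\operatorname{Adm}_{\vec\Lambda}[\mathfrak m]$, $${}'\mathcal F_{\vec m}^{\vec m'}(\lambda,x;\vec\Lambda)=\mathcal F_{\vec m}^{\vec m'}(\lambda,x;\vec\Lambda)-\mathcal F_{\vec\Lambda-\vec m}^{\vec m'}(-\lambda,x;\vec\Lambda).$$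
   Context: Fix $\eta\in\mathbb C$ with $\operatorname{Im}\eta>0$; $q^x=e^{\pi i\eta x}$, $[x]=\frac{q^x-q^{-x}}{q-q^{-1}}$, $[x]_k=[x][x+1]\cdots[x+k-1]$, $[k]!=[1]\cdots[k]$. $\mathcal Z^n=(\mathbb Z_{\ge0})^n$, $\mathcal Z^n[\mathfrak m]=\{\vec m\in\mathcal Z^n:\sum m_i=\mathfrak m\}$ (so $\mathcal Z^n[2\mathfrak m]$ is the set of nonnegative integer vectors with sum $2\mathfrak m$). For $\vec\Lambda\in\mathcal Z^n$, $\operatorname{Adm}_{\vec\Lambda}[\mathfrak m]=\{\vec m\in\mathcal Z^n[\mathfrak m]:m_i\le\Lambda_i\ \forall i\}$. $\mathcal U_q(\mathfrak{sl}_2)$ is the unital algebra generated by $\mathbf E,\mathbf F,q^{x\mathbf h}$ ($x\in\mathbb C$) with $q^{x\mathbf h}q^{y\mathbf h}=q^{(x+y)\mathbf h}$, $q^{x\mathbf h}\mathbf E=q^{2x}\mathbf Eq^{x\mathbf h}$, $q^{x\mathbf h}\mathbf F=q^{-2x}\mathbf Fq^{x\mathbf h}$, $\mathbf{EF}-\mathbf{FE}=\frac{q^{\mathbf h}-q^{-\mathbf h}}{q-q^{-1}}$, with comultiplication $\Delta\mathbf E=\mathbf E\otimes1+q^{\mathbf h}\otimes\mathbf E$, $\Delta\mathbf F=\mathbf F\otimes q^{-\mathbf h}+1\otimes\mathbf F$, $\Delta q^{x\mathbf h}=q^{x\mathbf h}\otimes q^{x\mathbf h}$. $M_\lambda$ is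 the Verma module with highest weight vector $v_\lambda$ of weight $\lambda$ and basis $v_\lambda^{(k)}=\mathbf F^kv_\lambda/[k]!$, $k\ge0$. For $\lambda\in\mathbb Z_{>0}$ the vectors $v_{\lambda-1}^{(k)}$, $k\ge\lambda$, span a submodule of $M_{\lambda-1}$ (isomorphic to $M_{-\lambda-1}$), and $L_{\lambda-1}$ is the ($\lambda$-dimensional) quotient. $M_\Lambda^\star$ has basis $\{u_m^\Lambda\}_{m\ge0}$ with $\mathbf Eu_m^\Lambda=[m]u_{m-1}^\Lambda$, $q^{x\mathbf h}u_m^\Lambda=q^{(\Lambda-2m)x}u_m^\Lambda$, $\mathbf Fu_m^\Lambda=[\Lambda-m]u_{m+1}^\Lambda$; for $\Lambda\in\mathbb Z_{\ge0}$, $L_\Lambda^\star\subset M_\Lambda^\star$ is the submodule spanned by $u_0^\Lambda,\dots,u_\Lambda^\Lambda$. $v_{\vec\Lambda}^{(\vec m)}=\otimes_iv_{\Lambda_i}^{(m_i)}$, $u_{\vec m}^{\vec\Lambda}=\otimes_iu_{m_i}^{\Lambda_i}$; the zero weight space $L_{\vec\Lambda}[0]$ of $L_{\Lambda_1}\otimes\dots\otimes L_{\Lambda_n}$ has basis $\{v_{\vec\Lambda}^{(\vec m)}\}_{\vec m\in\operatorname{Adm}_{\vec\Lambda}[\mathfrak m]}$. Intertwiners: $\Phi_m^\Lambda(\lambda):M_{\lambda-1}\to M_{\lambda-\Lambda+2m-1}\otimes M_\Lambda^\star$ is the module map determined by $\Phi_m^\Lambda(\lambda)v_{\lambda-1}=\sum_{i=0}^mq^{i(\lambda-\Lambda+2m-i)}[-\lambda+\Lambda-2m+i+1]_{m-i}\,v^{(i)}_{\lambda-\Lambda+2m-1}\otimes\mathbf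 E^iu_m^\Lambda$; $\Phi_{\vec m}^{\vec\Lambda}(\lambda)=\big(\Phi_{m_1}^{\Lambda_1}(\lambda-\sum_{i=2}^n(\Lambda_i-2m_i))\otimes1^{n-1}\big)\cdots\big(\Phi_{m_{n-1}}^{\Lambda_{n-1}}(\lambda-\Lambda_n+2m_n)\otimes1\big)\Phi_{m_n}^{\Lambda_n}(\lambda)$. For $\lambda\in\mathbb Z_{>0}$, $\vec\Lambda\in\mathcal Z^n[2\mathfrak m]$, $\vec m\in\operatorname{Adm}_{\vec\Lambda}[\mathfrak m]$, the operator $\Phi_{\vec m}^{\vec\Lambda}(\lambda):M_{\lambda-1}\to M_{\lambda-1}\otimes L_{\Lambda_1}^\star\otimes\dots\otimes L_{\Lambda_n}^\star$ induces (this is known) an operator on quotients ${}'\Phi_{\vec m}^{\vec\Lambda}(\lambda):L_{\lambda-1}\to L_{\lambda-1}\otimes L_{\Lambda_1}^\star\otimes\dots\otimes L_{\Lambda_n}^\star$. Trace functions: with $c(x)=q^{-\mathfrak m(\mathfrak m+1)/2}(q-q^{-1})^{\mathfrak m}(q^x-q^{-x})$, for $\vec m\in\operatorname{Adm}_{\vec\Lambda}[\mathfrak m]$, $$c(x)\operatorname{Tr}|_{M_{\lambda-1}}\big(\Phi_{\vec m}^{\vec\Lambda}(\lambda)q^{x\mathbf h}\big)=\sum_{\vec m'}\mathcal F_{\vec m}^{\vec m'}(\lambda,x;\vec\Lambda)u_{\vec m'}^{\vec\Lambda},\qquad c(x)\operatorname{Tr}|_{L_{\lambda-1}}\big({}'\Phi_{\vec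 m}^{\vec\Lambda}(\lambda)q^{x\mathbf h}\big)=\sum_{\vec m'}{}'\mathcal F_{\vec m}^{\vec m'}(\lambda,x;\vec\Lambda)u_{\vec m'}^{\vec\Lambda};$$ the first trace (defined for all $\lambda\in\mathbb C$) converges for $|q^{2x}|\gg1$ and is continued meromorphically in $x$. The matrices with $\vec m,\vec m'\in\operatorname{Adm}_{\vec\Lambda}[\mathfrak m]$ are regarded as maps $v_{\vec\Lambda}^{(\vec m')}\mapsto\sum_{\vec m}\mathcal F_{\vec m}^{\vec m'}v_{\vec\Lambda}^{(\vec m)}$ (similarly ${}'\mathcal F$). Weyl reflection on $L_{\vec\Lambda}[0]$-valued functions: $\mathbb S\big(\xi(\lambda)v_{\vec\Lambda}^{(\vec m)}\big)=\xi(-\lambda)v_{\vec\Lambda}^{(\vec\Lambda-\vec m)}$. *)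

(* Defs.v *)
From HB Require Import structures.
From mathcomp Require Import all_boot ssrAC all_order all_algebra.
From mathcomp Require Import finmap monalg complex ring lra.
From mathcomp Require Import all_classical all_reals all_analysis.

Set Implicit Arguments.
Unset Strict Implicit.
Unset Printing Implicit Defensive.

Import Order.TTheory GRing.Theory Num.Theory.
Import numFieldNormedType.Exports.

Local Open Scope classical_set_scope.
Local Open Scope ring_scope.
Local Open Scope complex_scope.

(* Vector spaces are given with a basis: {malg C[I]} is the free C-vector space
   on I, << i >> is the basis vector of index i, v@_i is the coordinate of v at
   i, and the tensor product of the spaces on I and J is the space on I * J. *)

HB.lock Definition linext (C : fieldType) (I J : choiceType)
    (f : I -> {malg C[J]}) (v : {malg C[I]}) : {malg C[J]} :=
  \sum_(i <- msupp v) v@_i *: f i.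

Section FreeSpaces.
Variable C : fieldType.

Lemma linextE (I J : choiceType) (f : I -> {malg C[J]}) v :
  linext f v = \sum_(i <- msupp v) v@_i *: f i.
Proof. by rewrite linext.unlock. Qed.

Lemma linextEw (I J : choiceType) (f : I -> {malg C[J]}) v (d : {fset I}) :
  (msupp v `<=` d)%fset -> linext f v = \sum_(i <- d) v@_i *: f i.
Proof.
move=> sd; rewrite linextE; apply: big_fset_incl => // i _ /mcoeff_outdom ->.
by rewrite scale0r.
Qed.

Lemma linext_is_linear (I J : choiceType) (f : I -> {malg C[J]}) :
  linear (linext f).
Proof.
move=> a u v.
pose d := (msupp u `|` msupp v `|` msupp (a *: u + v))%fset.
have su : (msupp u `<=` d)%fset by rewrite /d -fsetUA fsubsetUl.
have sv : (msupp v `<=` d)%fset by rewrite /d (fsetUC (msupp u)) -fsetUA fsubsetUl.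
have sw : (msupp (a *: u + v) `<=` d)%fset by rewrite /d fsubsetUr.
rewrite (linextEw f su) (linextEw f sv) (linextEw f sw) scaler_sumr -big_split.
by apply: eq_bigr => i _; rewrite mcoeffD mcoeffZ scalerDl scalerA.
Qed.

HB.instance Definition _ (I J : choiceType) (f : I -> {malg C[J]}) :=
  GRing.isLinear.Build C {malg C[I]} {malg C[J]} *:%R (linext f)
    (linext_is_linear f).

Lemma linextU (I J : choiceType) (f : I -> {malg C[J]}) i :
  linext f << i >> = f i.
Proof.
have s1 : (msupp (<< i >> : {malg C[I]}) `<=` [fset i])%fset by exact: msuppU_le.
by rewrite (linextEw f s1) big_seq_fset1 mcoeffUU scale1r.
Qed.

Lemma eq_linear (I J : choiceType) (f g : {malg C[I]} -> {malg C[J]}) :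
  linear f -> linear g -> (forall i, f << i >> = g << i >>) -> f =1 g.
Proof.
move=> lf lg fg v.
pose F : {linear _ -> _} := HB.pack f (GRing.isLinear.Build _ _ _ _ _ lf).
pose G : {linear _ -> _} := HB.pack g (GRing.isLinear.Build _ _ _ _ _ lg).
rewrite -[LHS]/(F v) -[RHS]/(G v) [v]monalgE !linear_sum.
apply: eq_bigr => i _.
have -> : << v@_i *g i >> = v@_i *: << i >> :> {malg C[I]}.
  by apply/malgP => j; rewrite mcoeffZ !mcoeffU mulrnAr mulr1.
by rewrite !linearZ /= fg.
Qed.

Definition tens (I J : choiceType) (u : {malg C[I]}) (v : {malg C[J]}) :
    {malg C[(I * J)%type]} :=
  linext (fun i => linext (fun j => << (i, j) >>) v) u.

Definition tmap (I J I' J' : choiceType)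
    (f : {malg C[I]} -> {malg C[I']}) (g : {malg C[J]} -> {malg C[J']}) :
    {malg C[(I * J)%type]} -> {malg C[(I' * J')%type]} :=
  linext (fun p : (I * J)%type => tens (f << p.1 >>) (g << p.2 >>)).

HB.instance Definition _ (I J I' J' : choiceType)
    (f : {malg C[I]} -> {malg C[I']}) (g : {malg C[J]} -> {malg C[J']}) :=
  GRing.Linear.copy (tmap f g)
    (linext (fun p : (I * J)%type => tens (f << p.1 >>) (g << p.2 >>))).

Lemma tensDl (I J : choiceType) (u u' : {malg C[I]}) (v : {malg C[J]}) :
  tens (u + u') v = tens u v + tens u' v.
Proof. exact: linearD. Qed.

Lemma tensZl (I J : choiceType) a (u : {malg C[I]}) (v : {malg C[J]}) :
  tens (a *: u) v = a *: tens u v.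
Proof. exact: linearZ. Qed.

Lemma tensDr (I J : choiceType) (u : {malg C[I]}) (v v' : {malg C[J]}) :
  tens u (v + v') = tens u v + tens u v'.
Proof.
rewrite /tens !(linextE _ u) -big_split; apply: eq_bigr => i _ /=.
by rewrite -scalerDr; congr (_ *: _); exact: linearD.
Qed.

Lemma tensZr (I J : choiceType) a (u : {malg C[I]}) (v : {malg C[J]}) :
  tens u (a *: v) = a *: tens u v.
Proof.
rewrite /tens !(linextE _ u) scaler_sumr; apply: eq_bigr => i _ /=.
by rewrite linearZ /= !scalerA mulrC.
Qed.

Lemma tensBl (I J : choiceType) (u u' : {malg C[I]}) (v : {malg C[J]}) :
  tens (u - u') v = tens u v - tens u' v.
Proof. exact: linearB. Qed.

Lemma tensBr (I J : choiceType) (u : {malg C[I]}) (v v' : {malg C[J]}) :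
  tens u (v - v') = tens u v - tens u v'.
Proof. by rewrite -!scaleN1r tensDr tensZr. Qed.

Lemma tensU (I J : choiceType) (i : I) (j : J) :
  tens << i >> << j >> = << (i, j) >> :> {malg C[(I * J)%type]}.
Proof. by rewrite /tens !linextU. Qed.

Lemma tmap_tens (I J I' J' : choiceType)
    (f : {linear {malg C[I]} -> {malg C[I']}})
    (g : {linear {malg C[J]} -> {malg C[J']}}) u v :
  tmap f g (tens u v) = tens (f u) (g v).
Proof.
have Ef i : tmap f g (linext (fun j => << (i, j) >>) v) = tens (f << i >>) (g v).
  pose h w := tmap f g (linext (fun j => << (i, j) >>) w).
  apply: (@eq_linear _ _ h (fun w => tens (f << i >>) (g w))).
  - by move=> a x y; rewrite /h !linearP.
  - by move=> a x y; rewrite linearP tensDr tensZr.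
  - by move=> j; rewrite /h linextU /tmap linextU.
pose h w := tmap f g (tens w v).
apply: (@eq_linear _ _ h (fun w => tens (f w) (g v))).
- by move=> a x y; rewrite /h tensDl tensZl linearP.
- by move=> a x y; rewrite linearP tensDl tensZl.
- by move=> i; rewrite /h /tens linextU Ef.
Qed.

Lemma eq_linear_tens (I J K : choiceType)
    (f g : {malg C[(I * J)%type]} -> {malg C[K]}) :
  linear f -> linear g -> (forall u v, f (tens u v) = g (tens u v)) -> f =1 g.
Proof. by move=> lf lg fg; apply: eq_linear => // -[i j]; rewrite -tensU fg. Qed.

End FreeSpaces.

Section Meromorphic.
Variable R : realType.
Local Notation C := R[i].

Definition analytic_at (f : C -> C) (z0 : C) : Prop :=
  exists (a : nat -> C) (r : R), 0 < r /\
    forall z, `|z - z0| < r%:C ->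
      ((fun N : nat => \sum_(k < N) a k * (z - z0) ^+ k) : nat -> C^o) @ \oo
        --> (f z : C^o).

Definition has_pole (f : C -> C) (z0 : C) : Prop :=
  exists (N : nat) (g : C -> C) (r : R),
    [/\ (0 < N)%N, analytic_at g z0, g z0 != 0, 0 < r &
        forall z, 0 < `|z - z0| < r%:C -> f z = g z / (z - z0) ^+ N].

(* The value of f at a pole is irrelevant; removable singularities are
   required to be filled in. *)
Definition meromorphic (f : C -> C) : Prop :=
  forall z, analytic_at f z \/ has_pole f z.

End Meromorphic.

(* The function x |-> q^x, abstracted to its functional equation. *)
Record qexponential (C : fieldType) := QExponential {
  qfun :> C -> C;
  qpow0 : qfun 0 = 1;
  qpowD : forall x y, qfun (x + y) = qfun x * qfun y }.

Section QuantumGroup.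
Variables (C : fieldType) (qpow : qexponential C).

Lemma qpow_neq0 (x : C) : qpow x != 0.
Proof.
apply/eqP => q0; have := qpowD qpow x (- x).
by rewrite q0 mul0r subrr (qpow0 qpow) => /eqP; rewrite oner_eq0.
Qed.

Lemma qpowN x : qpow (- x) = (qpow x)^-1.
Proof.
by apply: (mulfI (qpow_neq0 x)); rewrite -qpowD subrr (qpow0 qpow) mulfV // qpow_neq0.
Qed.

Definition qnum (x : C) : C :=
  (qpow x - qpow (- x)) / (qpow 1 - qpow (- 1)).

Definition qpoch (x : C) (k : nat) : C := \prod_(j < k) qnum (x + j%:R).

Lemma qnum0 : qnum 0 = 0.
Proof. by rewrite /qnum oppr0 subrr mul0r. Qed.

Lemma qnum_comm (x y : C) :
  qnum (x + 1) * qnum y - qnum (y + 1) * qnum x = qnum (y - x).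
Proof.
rewrite /qnum; set d := qpow 1 - _.
have [->|d0] := eqVneq d 0; first by rewrite invr0 !mulr0 subrr.
rewrite /d !opprD !opprK !qpowD !qpowN in d0 *.
field.
rewrite !qpow_neq0 /= andbT; apply: contra d0 => /eqP h.
by apply/eqP; apply: (mulIf (qpow_neq0 1)); rewrite mul0r mulrBl mulVf ?qpow_neq0.
Qed.

Local Notation V I := {malg C[I]}.

(* A U_q(sl_2)-module with underlying space {malg C[I]}: the actions of E, F
   and q^(x h), subject to the defining relations. *)
Record uqModule (I : choiceType) := UqModule {
  opE : {linear V I -> V I};
  opF : {linear V I -> V I};
  opK : C -> {linear V I -> V I};
  uqK0 : forall v, opK 0 v = v;
  uqKK : forall x y v, opK x (opK y v) = opK (x + y) v;
  uqKE : forall x v, opK x (opE v) = qpow (2 * x) *: opE (opK x v);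
  uqKF : forall x v, opK x (opF v) = qpow (- (2 * x)) *: opF (opK x v);
  uqEF : forall v, opE (opF v) - opF (opE v) =
    (qpow 1 - qpow (- 1))^-1 *: (opK 1 v - opK (- 1) v) }.

Definition uq_hom (I J : choiceType) (M : uqModule I) (N : uqModule J)
    (f : V I -> V J) : Prop :=
  [/\ linear f,
      forall v, f (opE M v) = opE N (f v),
      forall v, f (opF M v) = opF N (f v) &
      forall x v, f (opK M x v) = opK N x (f v)].

Section Verma.
Variable lam : C.

(* The index k stands for the basis vector F^k v / [k]!. *)
Definition vermaE (k : nat) : V nat :=
  if k is k'.+1 then qnum (lam - k%:R + 1) *: << k' >> else 0.
Definition vermaF (k : nat) : V nat := qnum k.+1%:R *: << k.+1 >>.
Definition wtK (x : C) (k : nat) : V nat :=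
  qpow ((lam - 2 * k%:R) * x) *: << k >>.

Definition dvermaE (m : nat) : V nat :=
  if m is m'.+1 then qnum m%:R *: << m' >> else 0.
Definition dvermaF (m : nat) : V nat := qnum (lam - m%:R) *: << m.+1 >>.

Lemma wtK0 v : linext (wtK 0) v = v.
Proof.
apply: (eq_linear (g := idfun)) v => [||k]; [exact: linearP|by []|].
by rewrite linextU /wtK mulr0 (qpow0 qpow) scale1r.
Qed.

Lemma wtKK x y v : linext (wtK x) (linext (wtK y) v) = linext (wtK (x + y)) v.
Proof.
apply: (eq_linear (f := linext (wtK x) \o linext (wtK y))) v => [||k].
- exact: linearP.
- exact: linearP.
- by rewrite /= !linextU linearZ /= linextU /wtK scalerA -qpowD mulrDr addrC.
Qed.

Lemma wtKshift (g : nat -> V nat) (h : nat -> C) x (s : C) (t : nat -> nat) :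
  (forall k, g k = h k *: << t k >>) ->
  (forall k, h k != 0 -> (t k)%:R = k%:R - s) ->
  forall v, linext (wtK x) (linext g v) =
    qpow (2 * s * x) *: linext g (linext (wtK x) v).
Proof.
move=> gE tE v.
apply: (eq_linear (f := linext (wtK x) \o linext g)
  (g := fun v => qpow (2 * s * x) *: linext g (linext (wtK x) v))) v => [||k].
- exact: linearP.
- by move=> a u w; rewrite !linearP.
rewrite /= !linextU gE /wtK !linearZ /= !linextU gE !scalerA.
have [->|/tE ->] := eqVneq (h k) 0; first by rewrite mulr0 mul0r scale0r.
by congr (_ *: _); rewrite mulrC -qpowD; congr (qpow _ * _); ring.
Qed.

Lemma wtKE (g : nat -> V nat) (h : nat -> C) :
  (forall k, g k = if k is k'.+1 then h k *: << k' >> else 0) ->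
  forall x v, linext (wtK x) (linext g v) =
    qpow (2 * x) *: linext g (linext (wtK x) v).
Proof.
move=> gE x v; rewrite -[2]mulr1.
apply: (@wtKshift _ (fun k => if k is 0%N then 0 else h k) _ _ predn) => [[|k]|[|k]].
- by rewrite gE scale0r.
- by rewrite gE.
- by rewrite eqxx.
- by rewrite -natr1 addrK.
Qed.

Lemma wtKF (g : nat -> V nat) (h : nat -> C) :
  (forall k, g k = h k *: << k.+1 >>) ->
  forall x v, linext (wtK x) (linext g v) =
    qpow (- (2 * x)) *: linext g (linext (wtK x) v).
Proof.
move=> gE x v; have -> : - (2 * x) = 2 * (- 1) * x by ring.
apply: (wtKshift _ gE) => k _.
by rewrite opprK natr1.
Qed.

Lemma wtEF (e f : nat -> V nat) (a b : nat -> C) :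
  (forall k, e k = if k is k'.+1 then a k *: << k' >> else 0) ->
  (forall k, f k = b k *: << k.+1 >>) ->
  (forall k, b k * a k.+1 - (if k is k'.+1 then a k * b k' else 0) =
     qnum (lam - 2 * k%:R)) ->
  forall v, linext e (linext f v) - linext f (linext e v) =
    (qpow 1 - qpow (- 1))^-1 *: (linext (wtK 1) v - linext (wtK (- 1)) v).
Proof.
move=> eE fE ab v.
apply: (eq_linear (f := fun v => linext e (linext f v) - linext f (linext e v))
  (g := fun v => (qpow 1 - qpow (- 1))^-1 *:
                 (linext (wtK 1) v - linext (wtK (- 1)) v))) v => [||k].
- by move=> c u w; rewrite !linearP addrACA -scalerDr.
- move=> c u w; rewrite !(linearP (linext _)) opprD addrACA -scalerBr.
  by rewrite scalerDr !scalerA mulrC.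
rewrite !linextU /wtK mulr1 mulrN1 -scalerBl scalerA mulrC -/(qnum _) -ab.
rewrite fE linearZ /= linextU eE scalerA scalerBl; congr (_ - _).
case: k {ab} => [|k]; rewrite eE ?linear0 ?scale0r //.
by rewrite linearZ /= linextU fE scalerA.
Qed.

Lemma vermaEF k :
  qnum k.+1%:R * qnum (lam - k.+1%:R + 1) -
  (if k is k'.+1 then qnum (lam - k%:R + 1) * qnum k'.+1%:R else 0) =
  qnum (lam - 2 * k%:R).
Proof.
have -> : lam - 2 * k%:R = (lam - k%:R) - k%:R by ring.
rewrite -[RHS]qnum_comm -natr1; congr (_ * qnum _ - _); first by ring.
case: k => [|//]; by rewrite qnum0 mulr0.
Qed.

Lemma dvermaEF k :
  qnum (lam - k%:R) * qnum k.+1%:R -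
  (if k is k'.+1 then qnum k%:R * qnum (lam - k'%:R) else 0) =
  qnum (lam - 2 * k%:R).
Proof.
have -> : lam - 2 * k%:R = (lam - k%:R) - k%:R by ring.
rewrite -[RHS]qnum_comm -natr1 [in LHS]mulrC; congr (_ - _).
case: k => [|k]; first by rewrite qnum0 mulr0.
by rewrite [RHS]mulrC; congr (_ * qnum _); rewrite -[k.+1%:R]natr1; ring.
Qed.

Definition Verma : uqModule nat :=
  @UqModule nat (linext vermaE) (linext vermaF) (fun x => linext (wtK x))
    wtK0 wtKK (wtKE (fun=> erefl)) (wtKF (fun=> erefl))
    (wtEF (fun=> erefl) (fun=> erefl) vermaEF).

Definition dualVerma : uqModule nat :=
  @UqModule nat (linext dvermaE) (linext dvermaF) (fun x => linext (wtK x))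
    wtK0 wtKK (wtKE (fun=> erefl)) (wtKF (fun=> erefl))
    (wtEF (fun=> erefl) (fun=> erefl) dvermaEF).

End Verma.

Section Tensor.
Variables (I J : choiceType) (M : uqModule I) (N : uqModule J).

Definition tensE : {linear V (I * J)%type -> V (I * J)%type} :=
  tmap (opE M) idfun \+ tmap (opK M 1) (opE N).
Definition tensF : {linear V (I * J)%type -> V (I * J)%type} :=
  tmap (opF M) (opK N (- 1)) \+ tmap idfun (opF N).
Definition tensK (x : C) : {linear V (I * J)%type -> V (I * J)%type} :=
  tmap (opK M x) (opK N x).

Lemma tensE_tens u v :
  tensE (tens u v) = tens (opE M u) v + tens (opK M 1 u) (opE N v).
Proof. by rewrite /tensE /= !tmap_tens. Qed.

Lemma tensF_tens u v :
  tensF (tens u v) = tens (opF M u) (opK N (- 1) v) + tens u (opF N v).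
Proof. by rewrite /tensF /= !tmap_tens. Qed.

Lemma tensK_tens x u v : tensK x (tens u v) = tens (opK M x u) (opK N x v).
Proof. by rewrite /tensK /= !tmap_tens. Qed.

Lemma tensK0 v : tensK 0 v = v.
Proof.
apply: (eq_linear_tens (g := idfun)) v => [||u w]; [exact: linearP|by []|].
by rewrite tensK_tens !uqK0.
Qed.

Lemma tensKK x y v : tensK x (tensK y v) = tensK (x + y) v.
Proof.
apply: (eq_linear_tens (f := tensK x \o tensK y)) v => [||u w].
- exact: linearP.
- exact: linearP.
- by rewrite /= !tensK_tens !uqKK.
Qed.

Lemma tensKE x v : tensK x (tensE v) = qpow (2 * x) *: tensE (tensK x v).
Proof.
apply: (eq_linear_tens (f := fun v => tensK x (tensE v))
  (g := fun v => qpow (2 * x) *: tensE (tensK x v))) v => [||u w].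
- by move=> a u w; rewrite !linearP.
- by move=> a u w; rewrite !linearP.
rewrite tensK_tens !tensE_tens linearD !tensK_tens !uqKE.
by rewrite tensZl tensZr scalerDr !uqKK [1 + x]addrC.
Qed.

Lemma tensKF x v : tensK x (tensF v) = qpow (- (2 * x)) *: tensF (tensK x v).
Proof.
apply: (eq_linear_tens (f := fun v => tensK x (tensF v))
  (g := fun v => qpow (- (2 * x)) *: tensF (tensK x v))) v => [||u w].
- by move=> a u w; rewrite !linearP.
- by move=> a u w; rewrite !linearP.
rewrite tensK_tens !tensF_tens linearD !tensK_tens !uqKF.
by rewrite tensZl tensZr scalerDr !uqKK [- 1 + x]addrC.
Qed.

Lemma tensEF v : tensE (tensF v) - tensF (tensE v) =
  (qpow 1 - qpow (- 1))^-1 *: (tensK 1 v - tensK (- 1) v).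
Proof.
apply: (eq_linear_tens (f := fun v => tensE (tensF v) - tensF (tensE v))
  (g := fun v => (qpow 1 - qpow (- 1))^-1 *: (tensK 1 v - tensK (- 1) v)))
  v => [||u w].
- by move=> c u w; rewrite !linearP addrACA -scalerDr.
- move=> c u w; rewrite !(linearP (tensK _)) opprD addrACA -scalerBr.
  by rewrite scalerDr !scalerA mulrC.
rewrite tensF_tens tensE_tens (linearD tensE) (linearD tensF).
rewrite !tensE_tens !tensF_tens !tensK_tens.
rewrite uqKF uqKE tensZl tensZr mulrN1 mulr1.
set b := _ *: tens _ _; set c := tens (opE M u) _.
rewrite [X in X - _](AC (2 * 2) ((1 * 4) * (3 * 2))).
rewrite [X in _ - X](AC (2 * 2) ((1 * 4) * (2 * 3))).
rewrite opprD addrACA subrr addr0 opprD addrACA -tensBl -tensBr !uqEF.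
rewrite tensZl tensZr -scalerDr tensBl tensBr; congr (_ *: _).
by rewrite addrC addrA subrK.
Qed.

Definition tensor : uqModule (I * J)%type :=
  @UqModule (I * J)%type tensE tensF tensK tensK0 tensKK tensKE tensKF tensEF.

End Tensor.

Definition Phi_vec (Lam : C) (m : nat) (lam : C) : V (nat * nat)%type :=
  \sum_(i < m.+1)
    (qpow (i%:R * (lam - Lam + 2 * m%:R - i%:R)) *
     qpoch (- lam + Lam - 2 * m%:R + i%:R + 1) (m - i)) *:
    tens << val i >> (iter i (opE (dualVerma Lam)) << m >>).

Definition is_Phi (Lam : C) (m : nat) (lam : C)
    (f : V nat -> V (nat * nat)%type) : Prop :=
  uq_hom (Verma (lam - 1))
    (tensor (Verma (lam - Lam + 2 * m%:R - 1)) (dualVerma Lam)) f /\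
  f << 0%N >> = Phi_vec Lam m lam.

(* F^k << 0 >> = [k]! << k >>, so at most one map satisfies is_Phi as long as q
   is not a root of unity. *)
Definition Phi (Lam : C) (m : nat) (lam : C) : V nat -> V (nat * nat)%type :=
  xget (fun=> 0) [set f | is_Phi Lam m lam f].

(* The index (k, [:: m_1; ...; m_n]) stands for
   v^(k) (x) u_(m_1) (x) ... (x) u_(m_n); a sequence s of pairs
   (Lambda_i, m_i) encodes the two multi-indices. *)
Definition tcons : V ((nat * nat) * seq nat)%type -> V (nat * seq nat)%type :=
  linext (fun p : ((nat * nat) * seq nat)%type =>
    << (p.1.1, p.1.2 :: p.2) >>).

Fixpoint PhiN (s : seq (C * nat)) (lam : C) :
    V nat -> V (nat * seq nat)%type :=
  if s is (Lam, m) :: s' then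
    tcons \o
    tmap (Phi Lam m (lam - \sum_(p <- s') (p.1 - 2 * p.2%:R))) idfun \o
    PhiN s' lam
  else linext (fun k => << (k, [::]) >>).

(* For lam > 0, the quotient of M_(lam - 1) by the span of the v^(k), k >= lam,
   has as basis the images of the v^(k), k < lam. *)
Definition projL (lam : nat) : V nat -> V 'I_lam :=
  linext (fun k => if insub k is Some i then << i >> else 0).

Definition qhL (lam : nat) (x : C) : V 'I_lam -> V 'I_lam :=
  linext (fun i : 'I_lam => qpow ((lam%:R - 1 - 2 * i%:R) * x) *: << i >>).

Definition is_PhiL (s : seq (C * nat)) (lam : nat)
    (g : V 'I_lam -> V ('I_lam * seq nat)%type) : Prop :=
  linear g /\ forall v, g (projL lam v) = tmap (projL lam) idfun (PhiN s lam%:R v).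

Definition PhiL (s : seq (C * nat)) (lam : nat) :
    V 'I_lam -> V ('I_lam * seq nat)%type :=
  xget (fun=> 0) [set g | is_PhiL s g].

End QuantumGroup.

Section TraceFunctions.
Variables (R : realType) (eta : R[i]).
Local Notation C := R[i].

Definition cexp (z : C) : C :=
  (expR (complex.Re z))%:C * (cos (complex.Im z) +i* sin (complex.Im z)).

Lemma cexpD (x y : C) : cexp (x + y) = cexp x * cexp y.
Proof.
case: x y => [a b] [c d]; rewrite /cexp /= expRD cosD sinD.
by apply/eqP; rewrite eq_complex /=; apply/andP; split; apply/eqP; ring.
Qed.

Lemma cexp0 : cexp 0 = 1.
Proof. by rewrite /cexp /= expR0 cos0 sin0 mul1r. Qed.

Definition qexp_fun (x : C) : C := cexp (pi%:C * (0 +i* 1) * eta * x).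

Lemma qexp0 : qexp_fun 0 = 1.
Proof. by rewrite /qexp_fun mulr0 cexp0. Qed.

Lemma qexpD x y : qexp_fun (x + y) = qexp_fun x * qexp_fun y.
Proof. by rewrite /qexp_fun mulrDr cexpD. Qed.

Definition qexp : qexponential C := QExponential qexp0 qexpD.

Definition cfactor (mm : nat) (x : C) : C :=
  qexp (- ((mm * mm.+1)%:R / 2)) * (qexp 1 - qexp (- 1)) ^+ mm *
  (qexp x - qexp (- x)).

Definition weights (L m : seq nat) : seq (C * nat) :=
  [seq (p.1%:R, p.2) | p <- zip L m].

(* The k-th diagonal coefficient, at u_(m'), of Phi_m(lam) q^(x h) on
   M_(lam - 1). *)
Definition trace_term (L m m' : seq nat) (lam x : C) (k : nat) : C :=
  (PhiN qexp (weights L m) lam (opK (Verma qexp (lam - 1)) x << k >>))@_(k, m').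

Definition is_calF (mm : nat) (L m m' : seq nat) (lam : C) (f : C -> C) :
    Prop :=
  meromorphic f /\
  exists B : R, forall x, B%:C < `|qexp (2 * x)| ->
    ((fun N : nat =>
        cfactor mm x * \sum_(k < N) trace_term L m m' lam x k) : nat -> C^o)
      @ \oo --> (f x : C^o).

(* The entry of lower index m and upper index m', as a function of x: the unique
   meromorphic function extending cfactor times the trace, which converges for
   |q^(2 x)| large. *)
Definition calF (mm : nat) (L m m' : seq nat) (lam : C) : C -> C :=
  xget (fun=> 0) [set f | is_calF mm L m m' lam f].

(* The target L_(lam - 1) (x) L*_(Lambda_1) (x) ... embeds in
   L_(lam - 1) (x) M*_(Lambda_1) (x) ... with the same coordinates. *)
Definition calFL (mm : nat) (L m m' : seq nat) (lam : nat) (x : C) : C :=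
  cfactor mm x *
  \sum_(k < lam) (PhiL qexp (weights L m) (qhL qexp x << k >>))@_(k, m').

Section Maps.
Variables (n mm : nat) (L : n.-tuple nat).
Local Notation V := {malg C[n.-tuple nat]}.

Definition Adm : set (n.-tuple nat) :=
  [set m | (\sum_(i < n) tnth m i = mm)%N /\ forall i, (tnth m i <= tnth L i)%N].

(* L_Lambda[0] is the span of the << m >> with m admissible. *)
Definition in_zero_weight (v : V) : Prop := forall m, v@_m != 0 -> Adm m.

Definition calF_map (lam x : C) : V -> V :=
  linext (fun m' : n.-tuple nat =>
    \sum_(m \in Adm) calF mm L m m' lam x *: << m >>).

Definition calFL_map (lam : nat) (x : C) : V -> V :=
  linext (fun m' : n.-tuple nat =>
    \sum_(m \in Adm) calFL mm L m m' lam x *: << m >>).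

Definition tuple_sub (m : n.-tuple nat) : n.-tuple nat :=
  [tuple (tnth L i - tnth m i)%N | i < n].

Definition weyl (xi : C -> V) (lam : C) : V :=
  linext (fun m => << tuple_sub m >>) (xi (- lam)).

End Maps.

End TraceFunctions.

(* Main.v *)
From HB Require Import structures.
Require Import Defs.
From mathcomp Require Import all_boot all_order all_algebra.
From mathcomp Require Import finmap monalg complex ring lra zify.
From mathcomp Require Import all_classical all_reals all_analysis.

Set Implicit Arguments.
Unset Strict Implicit.
Unset Printing Implicit Defensive.

Import Order.TTheory GRing.Theory Num.Theory.
Import numFieldNormedType.Exports.

Local Open Scope classical_set_scope.
Local Open Scope ring_scope.

(** Let lam > 0. The span of the v^(k) with k >= lam is a submodule of M_(lam-1)
    isomorphic to M_(-lam-1), and the operator Phi_m(lam) maps it to its tensor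
    product with the other factors. So the trace on L_(lam-1) is the trace on
    M_(lam-1) minus the trace on this submodule, and the point is that the
    restriction of Phi_m(lam) to M_(-lam-1) is Phi_(Lambda-m)(-lam), exactly and
    not only up to a factor.

    For a single factor this holds because a singular vector of M_mu (x) M*_Lam is
    determined by its component at u_0 (singular_slice0): the restriction and
    Phi_(Lam-m)(-lam) are module maps from the same Verma module, and the two
    components at u_0 of the image of its highest weight vector are computed and
    found equal (Phi_reflection_ge0). In a composite the intermediate weights are
    arbitrary integers, and the embedding of one of M_(l-1), M_(-l-1) in the other
    changes direction with the sign of l. Therefore the induction over the factors
    carries a relation between the two modules, equality in M_(|l|-1), which is
    preserved by every factor (Phi_reflection, PhiN_reflection). Its consequence
    for the diagonal coefficients is PhiN_diag_shift.

    This compares the two traces term by term where they converge. The trace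
    functions themselves are meromorphic continuations, and so one also needs that
    they exist and are unique. For existence, the diagonal coefficients of the
    operators are, for large k, sums of exponentials q^(s k) (expsum_PhiN_coord),
    so that the trace is a finite sum of geometric series in q^(-2x) and thus a
    quotient of entire functions (calF_is_calF). Uniqueness is the identity theorem
    for meromorphic functions (identity_theorem), which rests on an elementary
    theory of power series: sums, products, quotients, and isolated zeros. *)

(** * Slices of tensors *)

Section FreeSpaceMaps.
Variable C : fieldType.
Local Notation V I := {malg C[I]}.

Lemma mcoeff_basis (I : choiceType) (i j : I) : (<< i >> : V I)@_j = (i == j)%:R.
Proof. by rewrite mcoeffU. Qed.

(** Slices turn identities in tensor products into identities in the first
    factor: slice j is the linear form dual to the basis vector j, applied to
    the second factor. *)
Definition slice (I J : choiceType) (j : J) : V (I * J)%type -> V I :=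
  linext (fun p : (I * J)%type => if p.2 == j then << p.1 >> else 0).

Lemma slice_is_linear (I J : choiceType) (j : J) : linear (@slice I J j).
Proof. exact: linearP. Qed.

HB.instance Definition _ (I J : choiceType) (j : J) :=
  GRing.isLinear.Build C {malg C[(I * J)%type]} {malg C[I]} *:%R
    (@slice I J j) (slice_is_linear j).

Arguments slice : simpl never.

Lemma slice_tens (I J : choiceType) (j : J) (u : V I) (v : V J) :
  slice j (tens u v) = v@_j *: u.
Proof.
apply: (@eq_linear _ _ _ (fun u => slice j (tens u v)) (fun u => v@_j *: u)).
- by move=> a x y; rewrite tensDl tensZl linearP.
- by move=> a x y; rewrite scalerDr !scalerA mulrC.
move=> i; apply: (@eq_linear _ _ _ (fun v => slice j (tens << i >> v))
  (fun v => v@_j *: << i >>)).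
- by move=> a x y; rewrite tensDr tensZr linearP.
- by move=> a x y; rewrite mcoeffD mcoeffZ scalerDl scalerA.
move=> k; rewrite tensU /slice linextU mcoeff_basis /=.
by case: (k == j); rewrite ?scale1r ?scale0r.
Qed.

Lemma mcoeff_slice (I J : choiceType) (v : V (I * J)%type) i j :
  v@_(i, j) = (slice j v)@_i.
Proof.
rewrite /slice linextE [v in LHS]monalgE !raddf_sum; apply: eq_bigr => -[k l] _ /=.
rewrite mcoeffU mcoeffZ xpair_eqE.
by case: (l == j); rewrite ?andbF ?mcoeff0 ?mulr0 // andbT mcoeff_basis mulr_natr.
Qed.

Lemma slice_tmap (I I' J : choiceType) (f : {linear V I -> V I'}) (j : J) v :
  slice j (tmap f idfun v) = f (slice j v).
Proof.
apply: (@eq_linear_tens _ _ _ _ (slice j \o tmap f idfun) (f \o slice j)) => [||u w].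
- exact: linearP.
- exact: linearP.
- by rewrite /= tmap_tens !slice_tens linearZ.
Qed.

Lemma slice_inj (I J : choiceType) (v w : V (I * J)%type) :
  (forall j, slice j v = slice j w) -> v = w.
Proof. by move=> vw; apply/malgP => -[i j]; rewrite !mcoeff_slice vw. Qed.

Lemma linear_fun (U W : lmodType C) (f : U -> W) :
  linear f -> exists g : {linear U -> W}, f = g.
Proof.
move=> lf; pose F : {linear U -> W} := HB.pack f (GRing.isLinear.Build _ _ _ _ _ lf).
by exists F.
Qed.

End FreeSpaceMaps.
Arguments slice : simpl never.

(** * Quantum numbers *)

Section QNumbers.
Variables (C : fieldType) (q : qexponential C).
Implicit Types x y : C.

Lemma qnumN x : qnum q (- x) = - qnum q x.
Proof. by rewrite /qnum opprK -opprB mulNr. Qed.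

Lemma qpochS x k : qpoch q x k.+1 = qnum q x * qpoch q (x + 1) k.
Proof.
rewrite /qpoch big_ord_recl addr0; congr (_ * _); apply: eq_bigr => i _.
by rewrite -addrA nat1r.
Qed.

Lemma qpochSr x k : qpoch q x k.+1 = qpoch q x k * qnum q (x + k%:R).
Proof. by rewrite /qpoch big_ord_recr. Qed.

Lemma qpoch0 x : qpoch q x 0 = 1.
Proof. by rewrite /qpoch big_ord0. Qed.

Definition qfact k := qpoch q 1 k.

Lemma qfactS k : qfact k.+1 = qfact k * qnum q k.+1%:R.
Proof. by rewrite /qfact qpochSr nat1r. Qed.

Lemma qfact_add k n : qfact (k + n) = qfact k * qpoch q k.+1%:R n.
Proof.
elim: n => [|n ih]; first by rewrite addn0 qpoch0 mulr1.
by rewrite addnS qfactS ih qpochSr -mulrA -addSn natrD.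
Qed.

(** That is, q is not a root of unity. *)
Definition generic := forall n, qnum q n.+1%:R != 0.

Lemma qpoch_neq0 k n : generic -> qpoch q k.+1%:R n != 0.
Proof.
move=> hq; elim: n => [|n ih]; first by rewrite qpoch0 oner_neq0.
by rewrite qpochSr mulf_neq0 // -natrD addSn hq.
Qed.

Lemma qfact_neq0 k : generic -> qfact k != 0.
Proof. exact: (@qpoch_neq0 0). Qed.

End QNumbers.

(** * Verma modules and their universal property *)

Section ModuleActions.
Variables (C : fieldType) (q : qexponential C).

Lemma VermaF lam k : opF (Verma q lam) << k >> = qnum q k.+1%:R *: << k.+1 >>.
Proof. by rewrite /= linextU. Qed.

Lemma VermaE lam k : opE (Verma q lam) << k >> =
  if k is k'.+1 then qnum q (lam - k%:R + 1) *: << k' >> else 0.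
Proof. by rewrite /= linextU. Qed.

Lemma VermaK lam x k :
  opK (Verma q lam) x << k >> = q ((lam - 2 * k%:R) * x) *: << k >>.
Proof. by rewrite /= linextU. Qed.

Lemma dualE Lam m : opE (dualVerma q Lam) << m >> =
  if m is m'.+1 then qnum q m%:R *: << m' >> else 0.
Proof. by rewrite /= linextU. Qed.

Lemma dualF Lam m : opF (dualVerma q Lam) << m >> = qnum q (Lam - m%:R) *: << m.+1 >>.
Proof. by rewrite /= linextU. Qed.

Lemma dualK Lam x m :
  opK (dualVerma q Lam) x << m >> = q ((Lam - 2 * m%:R) * x) *: << m >>.
Proof. by rewrite /= linextU. Qed.

Section Tensor.
Variables (I J : choiceType) (M : uqModule q I) (N : uqModule q J).

Lemma tensorE u v : opE (tensor M N) (tens u v) =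
  tens (opE M u) v + tens (opK M 1 u) (opE N v).
Proof. exact: tensE_tens. Qed.

Lemma tensorF u v : opF (tensor M N) (tens u v) =
  tens (opF M u) (opK N (- 1) v) + tens u (opF N v).
Proof. exact: tensF_tens. Qed.

Lemma tensorK x u v : opK (tensor M N) x (tens u v) = tens (opK M x u) (opK N x v).
Proof. exact: tensK_tens. Qed.

End Tensor.

End ModuleActions.

Opaque Verma dualVerma tensor.

Section VermaUniversal.
Variables (C : fieldType) (q : qexponential C).
Hypothesis hq : generic q.
Local Notation V I := {malg C[I]}.

Lemma VermaFn lam n k : iter n (opF (Verma q lam)) << k >> =
  qpoch q k.+1%:R n *: << (k + n)%N >>.
Proof.
elim: n => [|n ih]; first by rewrite qpoch0 scale1r addn0.
by rewrite iterS ih linearZ /= VermaF scalerA qpochSr -natrD addSn addnS.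
Qed.

(** The vectors F^k << 0 >> span the Verma module as long as no [k]! vanishes. *)
Lemma VermaF_ext (I : choiceType) (f g : V nat -> V I) (F : V I -> V I) lam :
  linear f -> linear g ->
  (forall v, f (opF (Verma q lam) v) = F (f v)) ->
  (forall v, g (opF (Verma q lam) v) = F (g v)) ->
  f << 0%N >> = g << 0%N >> -> f =1 g.
Proof.
move=> lf lg fF gF f0; have [f' ff] := linear_fun lf; have [g' gg] := linear_fun lg.
apply: eq_linear => //; elim=> // k ih.
apply: (can_inj (scalerK (hq k))).
by rewrite ff gg -!linearZ /= -(VermaF q lam) -ff -gg fF gF ih.
Qed.

Section Hom.
Variables (I : choiceType) (N : uqModule q I) (lam : C) (w : V I).
Hypothesis wE : opE N w = 0.
Hypothesis wK : forall x, opK N x w = q (lam * x) *: w.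

Definition verma_hom : V nat -> V I :=
  linext (fun k => (qfact q k)^-1 *: iter k (opF N) w).

Lemma verma_hom_is_linear : linear verma_hom.
Proof. exact: linearP. Qed.

HB.instance Definition _ := GRing.isLinear.Build C {malg C[nat]} {malg C[I]} *:%R
  verma_hom verma_hom_is_linear.

Arguments verma_hom : simpl never.

Lemma verma_homU k : verma_hom << k >> = (qfact q k)^-1 *: iter k (opF N) w.
Proof. exact: linextU. Qed.

Lemma singularK x k :
  opK N x (iter k (opF N) w) = q ((lam - 2 * k%:R) * x) *: iter k (opF N) w.
Proof.
elim: k => [|k ih]; first by rewrite mulr0 subr0 wK.
rewrite iterS uqKF ih linearZ /= scalerA -qpowD; congr (q _ *: _).
by rewrite -natr1; ring.
Qed.

(** Commuting E past the powers of F one at a time telescopes, because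
    [k + 1] [lam - k] - [k] [lam - k + 1] = [lam - 2k]. *)
Lemma singularE k : opE N (iter k.+1 (opF N) w) =
  (qnum q k.+1%:R * qnum q (lam - k%:R)) *: iter k (opF N) w.
Proof.
elim: k => [|k ih]; rewrite iterS.
  have := uqEF N w; rewrite wE linear0 subr0 => ->; rewrite !wK -scalerBl scalerA.
  rewrite mulr1 mulrN1 mulrC -/(qnum q lam) subr0; congr (_ *: _).
  rewrite {2}/qnum mulfV ?mul1r //; have := hq 0.
  by apply: contraNneq => e; rewrite /qnum e mul0r.
have := uqEF N (iter k.+1 (opF N) w); move/(canRL (subrK _)) => ->.
rewrite ih linearZ /= -/(iter k.+1 (opF N) w) !singularK -scalerBl scalerA mulr1 mulrN1.
rewrite [_^-1 * _]mulrC -/(qnum q (lam - 2 * k.+1%:R)) -scalerDl; congr (_ *: _).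
have -> : lam - 2 * k.+1%:R = (lam - k.+1%:R) - k.+1%:R by ring.
rewrite -(qnum_comm q k.+1%:R) natr1.
have -> : lam - k.+1%:R + 1 = lam - k%:R by rewrite -natr1; ring.
by rewrite [qnum q k.+1%:R * _]mulrC subrK.
Qed.

(** The universal property of the Verma module: a singular vector of weight lam
    is the image of the highest weight vector under a module map. *)
Lemma verma_hom_uq : uq_hom (Verma q lam) N verma_hom.
Proof.
split=> [|v|v|x v]; first exact: linearP.
- apply: (@eq_linear _ _ _ (verma_hom \o opE (Verma q lam)) (opE N \o verma_hom)).
  + exact: linearP.
  + exact: linearP.
  case=> [|k] /=.
    by rewrite VermaE verma_homU !linear0 linearZ /= wE scaler0.
  rewrite VermaE !verma_homU !linearZ /= verma_homU singularE !scalerA.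
  congr (_ *: _); rewrite qfactS -natr1.
  have -> : lam - (k%:R + 1) + 1 = lam - k%:R by ring.
  by field; rewrite qfact_neq0 // natr1 hq.
- apply: (@eq_linear _ _ _ (verma_hom \o opF (Verma q lam)) (opF N \o verma_hom)).
  + exact: linearP.
  + exact: linearP.
  move=> k /=; rewrite VermaF !verma_homU !linearZ /= !verma_homU scalerA; congr (_ *: _).
  by rewrite qfactS; field; rewrite qfact_neq0 // hq.
- apply: (@eq_linear _ _ _ (verma_hom \o opK (Verma q lam) x) (opK N x \o verma_hom)).
  + exact: linearP.
  + exact: linearP.
  by move=> k /=; rewrite VermaK !verma_homU !linearZ /= verma_homU singularK !scalerA mulrC.
Qed.

Lemma verma_hom0 : verma_hom << 0%N >> = w.
Proof. by rewrite /verma_hom linextU /= /qfact qpoch0 invr1 scale1r. Qed.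

End Hom.
End VermaUniversal.
Arguments verma_hom : simpl never.

(** * Existence and uniqueness of the intertwiners *)

Section Intertwiner.
Variables (C : fieldType) (q : qexponential C).
Hypothesis hq : generic q.
Local Notation V I := {malg C[I]}.

Lemma dualEn Lam m i : (i <= m)%N -> iter i (opE (dualVerma q Lam)) << m >> =
  (qpoch q (m - i).+1%:R i) *: << (m - i)%N >>.
Proof.
elim: i => [|i ih] im; first by rewrite subn0 qpoch0 scale1r.
rewrite iterS ih ?(ltnW im) // linearZ /= -{2}(subnSK im) dualE scalerA.
by rewrite [qpoch q _ i.+1]qpochS natr1 subnSK // mulrC.
Qed.

Section TensorVerma.
Variables (mu Lam : C).
Local Notation T := (tensor (Verma q mu) (dualVerma q Lam)).

Lemma slice_tensE b w : slice b (opE T w) =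
  opE (Verma q mu) (slice b w) +
  qnum q b.+1%:R *: opK (Verma q mu) 1 (slice b.+1 w).
Proof.
apply: (@eq_linear _ _ _ (slice b \o opE T) (fun w => opE (Verma q mu) (slice b w) +
  qnum q b.+1%:R *: opK (Verma q mu) 1 (slice b.+1 w))).
- exact: linearP.
- by move=> c x y; rewrite !linearP /= addrACA -scalerDr.
case=> a c /=; rewrite -tensU tensorE linearD /= !slice_tens !mcoeff_basis !linearZ /=.
rewrite dualE scalerA; congr (_ + _).
case: c => [|c]; first by rewrite mcoeff0 mul0r !scale0r.
by rewrite mcoeffZ mcoeff_basis eqSS mulrC; have [->|_] := eqVneq c b; rewrite ?mul0r.
Qed.

Lemma slice0_tensF w :
  slice 0%N (opF T w) = q (- Lam) *: opF (Verma q mu) (slice 0%N w).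
Proof.
apply: (@eq_linear _ _ _ (slice 0%N \o opF T)
  (fun w => q (- Lam) *: opF (Verma q mu) (slice 0%N w))).
- exact: linearP.
- by move=> c x y; rewrite !linearP.
case=> a c /=; rewrite -tensU tensorF linearD /=.
have F0 : (opF (dualVerma q Lam) << c >>)@_0%N = 0.
  by rewrite dualF mcoeffZ mcoeff_basis mulr0.
have K0 : (opK (dualVerma q Lam) (- 1) << c >>)@_0%N = q (- Lam) * (c == 0%N)%:R.
  rewrite dualK mcoeffZ mcoeff_basis; case: c F0 => [|c] _; last by rewrite !mulr0.
  by rewrite mulr0 subr0 mulrN1.
rewrite [in LHS]slice_tens K0 [in X in _ + X]slice_tens F0 scale0r addr0.
by rewrite slice_tens mcoeff_basis linearZ /= scalerA.
Qed.

(** The E-equation expresses the slice at u_(b+1) through the slice at u_b, with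
    the nonzero factor [b + 1] and the invertible K. So a singular vector of
    M_mu (x) M*_Lam is determined by its component at u_0, whatever mu and Lam
    are; this is what makes the intertwiners comparable. *)
Lemma singular_slice0 w : opE T w = 0 -> slice 0%N w = 0 -> w = 0.
Proof.
move=> wE w0; apply: slice_inj => b; rewrite linear0; elim: b => // b ih.
have := slice_tensE b w; rewrite wE ih !linear0 add0r => /esym/eqP.
rewrite scaler_eq0 (negPf (hq b)) orFb => /eqP e.
have := uqKK (Verma q mu) (- 1) 1 (slice b.+1 w).
by rewrite e linear0 addNr uqK0.
Qed.

End TensorVerma.

Section PhiVec.
Variables (Lam : C) (m : nat) (lam : C).
Let mu := lam - Lam + 2 * m%:R.
Local Notation T := (tensor (Verma q (mu - 1)) (dualVerma q Lam)).

(** The two families of terms produced by the coproduct of E telescope: the term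
    i + 1 of the first cancels the term i of the second. *)
Lemma Phi_vecE : opE T (Phi_vec q Lam m lam) = 0.
Proof.
pose u i := iter i (opE (dualVerma q Lam)) << m >>.
pose c i := q (i%:R * (mu - i%:R)) * qpoch q (- mu + i%:R + 1) (m - i).
have -> : Phi_vec q Lam m lam = \sum_(i < m.+1) c i *: tens << (i : nat) >> (u i).
  apply: eq_bigr => i _; rewrite /c /mu; congr ((_ * qpoch q _ _) *: _); ring.
have uS i : opE (dualVerma q Lam) (u i) = u i.+1 by [].
have um : u m.+1 = 0.
  by rewrite /u iterS dualEn // subnn linearZ /= dualE scaler0.
rewrite linear_sum /=.
under eq_bigr => i _ do rewrite linearZ /= tensorE uS scalerDr.
rewrite big_split /= big_ord_recl VermaE.
rewrite [tens 0 _](_ : _ = 0) ?scaler0 ?add0r; last first.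
  by rewrite -(scale0r (0 : V nat)) tensZl scale0r.
rewrite [X in _ + X]big_ord_recr /= uS um [tens _ 0](_ : _ = 0) ?scaler0 ?addr0; last first.
  by rewrite -(scale0r (0 : V nat)) tensZr scale0r.
rewrite -big_split big1 // => i _; rewrite /bump leq0n add1n add0n !uS VermaE VermaK.
rewrite !tensZl !scalerA /= -scalerDl; apply/eqP; rewrite scaler_eq0; apply/orP; left.
apply/eqP; rewrite /c.
rewrite -[in X in _ + X](subnSK (ltn_ord i)) qpochS.
have -> : - mu + i%:R + 1 = - (mu - 1 - i.+1%:R + 1) by rewrite -natr1; ring.
rewrite qnumN.
have -> : - (mu - 1 - i.+1%:R + 1) + 1 = - mu + i.+1%:R + 1 by ring.
have -> : i.+1%:R * (mu - i.+1%:R) = i%:R * (mu - i%:R) + (mu - 1 - 2 * i%:R) * 1.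
  by rewrite -natr1; ring.
by rewrite qpowD; ring.
Qed.

Lemma Phi_vecK x :
  opK T x (Phi_vec q Lam m lam) = q ((lam - 1) * x) *: Phi_vec q Lam m lam.
Proof.
rewrite /Phi_vec linear_sum scaler_sumr; apply: eq_bigr => i _.
rewrite linearZ /= [RHS]scalerA [_ * (_ * qpoch _ _ _)]mulrC -[RHS]scalerA; congr (_ *: _).
have im : (i <= m)%N by rewrite -ltnS.
rewrite tensorK VermaK dualEn // linearZ /= dualK.
rewrite tensZl !tensZr !scalerA; congr (_ *: _).
rewrite mulrAC -qpowD; congr (q _ * _).
by rewrite /mu (natrB _ im); ring.
Qed.

Lemma slice0_Phi_vec : slice 0%N (Phi_vec q Lam m lam) =
  (q (m%:R * (mu - m%:R)) * qfact q m) *: << m >>.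
Proof.
rewrite /Phi_vec linear_sum big_ord_recr big1 /=.
  rewrite add0r linearZ /= slice_tens dualEn // subnn qpoch0 mcoeffZ mcoeff_basis eqxx.
  by rewrite !mulr1 scalerA.
move=> i _; rewrite linearZ /= slice_tens dualEn ?(ltnW (ltn_ord i)) //.
rewrite mcoeffZ mcoeff_basis; have : (0 < m - i)%N by rewrite subn_gt0.
by case: (m - i)%N => // j _; rewrite mulr0 scale0r scaler0.
Qed.

Lemma is_Phi_verma_hom : is_Phi q Lam m lam (verma_hom T (Phi_vec q Lam m lam)).
Proof.
split; last exact: verma_hom0.
exact: (verma_hom_uq hq Phi_vecE Phi_vecK).
Qed.

Lemma Phi_is_Phi : is_Phi q Lam m lam (Phi q Lam m lam).
Proof.
exact: (@xgetPex _ _ [set f | is_Phi q Lam m lam f] (ex_intro _ _ is_Phi_verma_hom)).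
Qed.

(** Existence comes from the universal property and uniqueness from the fact that
    F-equivariant maps are determined at the highest weight vector. *)
Lemma PhiE : Phi q Lam m lam = verma_hom T (Phi_vec q Lam m lam).
Proof.
have [[l1 _ F1 _] e1] := Phi_is_Phi; have [[l2 _ F2 _] e2] := is_Phi_verma_hom.
apply: funext; apply: (VermaF_ext hq l1 l2 F1 F2); by rewrite e1 e2.
Qed.

End PhiVec.

End Intertwiner.

(** * The reflection on a Verma module *)

Section Homs.
Variables (C : fieldType) (q : qexponential C).
Local Notation V I := {malg C[I]}.

Lemma uq_hom_comp (I J K : choiceType) (M : uqModule q I) (N : uqModule q J)
    (P : uqModule q K) f g :
  uq_hom M N f -> uq_hom N P g -> uq_hom M P (g \o f).
Proof.
move=> [lf fE fF fK] [lg gE gF gK]; split=> [a u v|v|v|x v] /=.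
- by rewrite lf lg.
- by rewrite fE gE.
- by rewrite fF gF.
- by rewrite fK gK.
Qed.

Lemma uq_hom_id (I : choiceType) (M : uqModule q I) : uq_hom M M idfun.
Proof. by split. Qed.

Lemma tensor_hom (I J K : choiceType) (M : uqModule q I) (N : uqModule q J)
    (P : uqModule q K) (f : {linear V I -> V J}) :
  uq_hom M N f -> uq_hom (tensor M P) (tensor N P) (tmap f idfun).
Proof.
move=> [_ fE fF fK]; split=> [|v|v|x v]; first exact: linearP.
- apply: (@eq_linear_tens _ _ _ _ (tmap f idfun \o opE (tensor M P))
    (opE (tensor N P) \o tmap f idfun)) v => [||u v]; try exact: linearP.
  by rewrite /= tmap_tens !tensorE linearD /= !tmap_tens fE fK.
- apply: (@eq_linear_tens _ _ _ _ (tmap f idfun \o opF (tensor M P))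
    (opF (tensor N P) \o tmap f idfun)) v => [||u v]; try exact: linearP.
  by rewrite /= tmap_tens !tensorF linearD /= !tmap_tens fF.
- apply: (@eq_linear_tens _ _ _ _ (tmap f idfun \o opK (tensor M P) x)
    (opK (tensor N P) x \o tmap f idfun)) v => [||u v]; try exact: linearP.
  by rewrite /= tmap_tens !tensorK !tmap_tens fK.
Qed.

End Homs.

Section Reflection.
Variables (C : fieldType) (q : qexponential C).
Hypothesis hq : generic q.
Local Notation V I := {malg C[I]}.

(** The embedding of M_(-n-1) in M_(n-1) as the submodule generated by F^n v:
    it sends F^k v to F^(k+n) v, hence the factor in the divided powers basis. *)
Definition embed n : V nat -> V nat :=
  linext (fun k => qpoch q k.+1%:R n *: << (k + n)%N >>).

Lemma embed_is_linear n : linear (embed n).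
Proof. exact: linearP. Qed.

HB.instance Definition _ n := GRing.isLinear.Build C {malg C[nat]} {malg C[nat]}
  *:%R (embed n) (embed_is_linear n).

Lemma embedU n k : embed n << k >> = qpoch q k.+1%:R n *: << (k + n)%N >>.
Proof. exact: linextU. Qed.

Lemma embed0 v : embed 0 v = v.
Proof.
apply: (@eq_linear _ _ _ (embed 0) idfun) => [||k]; first exact: linearP.
  by [].
by rewrite embedU qpoch0 scale1r addn0.
Qed.

Lemma mcoeff_embed n v k : (embed n v)@_(k + n)%N = qpoch q k.+1%:R n * v@_k.
Proof.
rewrite /embed linextE [in RHS](monalgE v) !raddf_sum mulr_sumr.
apply: eq_bigr => i _ /=; rewrite !mcoeffZ mcoeff_basis mcoeffU eqn_add2r.
have [->|_] := eqVneq i k; first by rewrite mulr1 mulr1n mulrC.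
by rewrite /= mulr0n !mulr0.
Qed.

Lemma mcoeff_embed_lt n v k : (k < n)%N -> (embed n v)@_k = 0.
Proof.
move=> kn; rewrite /embed linextE raddf_sum big1 //= => i _.
rewrite !mcoeffZ mcoeff_basis; have [e|_] := eqVneq; last by rewrite !mulr0.
by rewrite -e ltnNge leq_addl in kn.
Qed.

Lemma embed_hom n : uq_hom (Verma q (- n%:R - 1)) (Verma q (n%:R - 1)) (embed n).
Proof.
split=> [|v|v|x v]; first exact: linearP.
- apply: (@eq_linear _ _ _ (embed n \o opE (Verma q (- n%:R - 1)))
    (opE (Verma q (n%:R - 1)) \o embed n)) v => [||k]; try exact: linearP.
  rewrite /= embedU linearZ /= !VermaE.
  case: k => [|k].
    rewrite linear0; case: n => [|n]; first by rewrite scaler0.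
    rewrite add0n; have -> : n.+1%:R - 1 - n.+1%:R + 1 = 0 :> C by ring.
    by rewrite qnum0 scale0r scaler0.
  rewrite addSn linearZ /= embedU !scalerA; congr (_ *: _).
  have -> : n%:R - 1 - (k + n).+1%:R + 1 = - k.+1%:R :> C.
    by rewrite -addSn natrD; ring.
  have -> : - n%:R - 1 - k.+1%:R + 1 = - (k.+1 + n)%:R :> C by rewrite natrD; ring.
  rewrite !qnumN mulrN mulNr; congr (- _); rewrite [LHS]mulrC [RHS]mulrC natrD.
  by rewrite -qpochSr qpochS natr1.
- apply: (@eq_linear _ _ _ (embed n \o opF (Verma q (- n%:R - 1)))
    (opF (Verma q (n%:R - 1)) \o embed n)) v => [||k]; try exact: linearP.
  rewrite /= embedU linearZ /= !VermaF linearZ /= embedU !scalerA addSn.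
  congr (_ *: _); rewrite -addSn natrD -qpochSr qpochS; congr (_ * qpoch q _ _).
  by rewrite natr1.
- apply: (@eq_linear _ _ _ (embed n \o opK (Verma q (- n%:R - 1)) x)
    (opK (Verma q (n%:R - 1)) x \o embed n)) v => [||k]; try exact: linearP.
  rewrite /= embedU linearZ /= !VermaK linearZ /= embedU !scalerA mulrC.
  by congr (_ * q (_ * _) *: _); rewrite natrD; ring.
Qed.

Definition negpart (l : int) : nat := if l is Negz n then n.+1 else 0.

Lemma negpart_diff l : (negpart (- l))%:Z - (negpart l)%:Z = l.
Proof. by case: l => [[|n]|n]; rewrite /= ?subr0 // sub0r. Qed.

(** M_(l-1) as a submodule of M_(|l|-1), for an integer l of any sign. For l and
    - l the ambient module is the same, which treats all signs of the
    intermediate weights at once. *)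
Definition embed_abs l := embed (negpart l).

Lemma embed_abs_hom l : uq_hom (Verma q (l%:~R - 1)) (Verma q (`|l|%N%:R - 1)) (embed_abs l).
Proof.
case: l => [n|n]; last by exact: (embed_hom n.+1).
rewrite /embed_abs /=; have -> : embed 0 = idfun by apply: funext => v; exact: embed0.
exact: uq_hom_id.
Qed.

Lemma Phi_hom Lam m lam mu : mu = lam - Lam + 2 * m%:R ->
  uq_hom (Verma q (lam - 1)) (tensor (Verma q (mu - 1)) (dualVerma q Lam))
    (Phi q Lam m lam).
Proof. by move=> ->; have [] := Phi_is_Phi hq Lam m lam. Qed.

Lemma Phi_linear Lam m lam : linear (Phi q Lam m lam).
Proof. by have [[]] := Phi_is_Phi hq Lam m lam. Qed.

(** Only the summand F (x) K^(-1) of the coproduct of F preserves the component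
    at u_0, so that this component of the image of each basis vector is
    explicit. *)
Lemma slice0_Phi Lam m lam n : slice 0%N (Phi q Lam m lam << n >>) =
  (q (m%:R * (lam - Lam + 2 * m%:R - m%:R) - n%:R * Lam) *
   (qfact q (m + n) / qfact q n)) *: << (m + n)%N >>.
Proof.
rewrite PhiE // verma_homU linearZ /=.
set T := tensor _ _; set w := Phi_vec _ _ _ _.
have -> : slice 0%N (iter n (opF T) w) =
    q (- n%:R * Lam) *: iter n (opF (Verma q (lam - Lam + 2 * m%:R - 1))) (slice 0%N w).
  elim: n => [|n ih]; first by rewrite oppr0 mul0r qpow0 scale1r.
  rewrite !iterS slice0_tensF ih linearZ /= scalerA -qpowD.
  by congr (q _ *: _); rewrite -natr1; ring.
rewrite slice0_Phi_vec.
have iterZ k c v : iter k (opF (Verma q (lam - Lam + 2 * m%:R - 1))) (c *: v) =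
    c *: iter k (opF (Verma q (lam - Lam + 2 * m%:R - 1))) v.
  by elim: k => // k ih; rewrite !iterS ih linearZ.
rewrite iterZ VermaFn !scalerA; congr (_ *: _).
by rewrite qpowD qfact_add mulNr; field; rewrite qfact_neq0.
Qed.

(** Two module maps from a Verma module to M_mu (x) M*_Lam differ on the highest
    weight vector by a singular vector. *)
Lemma hom_eq_slice0 nu mu Lam (A B : V nat -> V (nat * nat)%type) :
  uq_hom (Verma q nu) (tensor (Verma q mu) (dualVerma q Lam)) A ->
  uq_hom (Verma q nu) (tensor (Verma q mu) (dualVerma q Lam)) B ->
  slice 0%N (A << 0%N >>) = slice 0%N (B << 0%N >>) -> A =1 B.
Proof.
move=> [lA EA FA _] [lB EB FB _] e0; apply: (VermaF_ext hq lA lB FA FB).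
have E0 : opE (Verma q nu) << 0%N >> = 0 by rewrite VermaE.
have [A' AA] := linear_fun lA; have [B' BB] := linear_fun lB.
have A0 : A 0 = 0 by rewrite AA linear0.
have B0 : B 0 = 0 by rewrite BB linear0.
apply/eqP; rewrite -subr_eq0; apply/eqP.
apply: (singular_slice0 hq (mu := mu) (Lam := Lam)).
  by rewrite linearB /= -EA -EB E0 A0 B0 subrr.
by rewrite linearB /= e0 subrr.
Qed.

(** Both sides are module maps from M_(-n-1) to M_(|mu|-1) (x) M*_Lam, so it is
    enough to compare the components at u_0 of the images of the highest weight
    vector. These are multiples of the same basis vector, and the two powers of q
    have the same exponent: the normalization of the intertwiners makes the
    proportionality constant equal to 1. *)
Lemma Phi_reflection_ge0 Lam m n (mu : int) w b : (m <= Lam)%N ->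
  mu = n%:Z - Lam%:Z + 2 * m%:Z ->
  embed_abs mu (slice b (Phi q Lam%:R m n%:R (embed n w))) =
  embed_abs (- mu) (slice b (Phi q Lam%:R (Lam - m) (- n%:R) w)).
Proof.
move=> mL muE.
have muC : mu%:~R = n%:R - Lam%:R + 2 * m%:R :> C.
  by rewrite muE !rmorphD rmorphN rmorphM.
have muC' : (- mu)%:~R = - n%:R - Lam%:R + 2 * (Lam - m)%:R :> C.
  by rewrite rmorphN /= muC natrB //; ring.
have h1 := Phi_hom muC; have h2 := Phi_hom muC'.
have [f fE] := linear_fun (Phi_linear Lam%:R m n%:R).
have hA := uq_hom_comp (uq_hom_comp (embed_hom n) h1)
  (tensor_hom (dualVerma q Lam%:R) (embed_abs_hom mu)).
have hB := uq_hom_comp h2 (tensor_hom (dualVerma q Lam%:R) (embed_abs_hom (- mu))).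
rewrite abszN in hB.
(* Both embeddings send the component at u_0 to the same degree. *)
have idx : (m + n + negpart mu = Lam - m + negpart (- mu))%N.
  apply/eqP; rewrite -eqz_nat !PoszD -subzn //.
  have := negpart_diff mu; rewrite {3}muE => /(canRL (subrK _)) ->.
  by apply/eqP; ring.
have AB : slice 0%N (tmap (embed_abs mu) idfun (Phi q Lam%:R m n%:R (embed n << 0%N >>))) =
    slice 0%N (tmap (embed_abs (- mu)) idfun (Phi q Lam%:R (Lam - m) (- n%:R) << 0%N >>)).
  rewrite !slice_tmap embedU add0n fE linearZ -fE linearZ /= !slice0_Phi.
  rewrite !linearZ /= /embed_abs !embedU !scalerA addn0 idx; congr (_ *: _).
  rewrite [qpoch q 1 n]/(qfact q n) [qfact q 0]/qfact qpoch0 divr1 -!mulrA.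
  rewrite -[in RHS]qfact_add -idx !qfact_add natrB // mul0r subr0 -!/(qfact q n).
  have -> : m%:R * (n%:R - Lam%:R + 2 * m%:R - m%:R) - n%:R * Lam%:R =
    (Lam%:R - m%:R) * (- n%:R - Lam%:R + 2 * (Lam%:R - m%:R) - (Lam%:R - m%:R)) :> C.
    by ring.
  by field; rewrite qfact_neq0.
have /(_ w) /= e := hom_eq_slice0 hA hB AB.
by rewrite -[LHS](slice_tmap (embed_abs mu)) e (slice_tmap (embed_abs (- mu))).
Qed.

(** The vectors u of M_(l-1) and w of M_(-l-1) become equal in M_(|l|-1). For l > 0
    this says that u lies in the submodule M_(-l-1) and corresponds to w there,
    for l < 0 the roles are exchanged. The relation, unlike either embedding, is
    preserved by all intertwiners. *)
Definition linked (l : int) (u w : V nat) := embed_abs l u = embed_abs (- l) w.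

Lemma linked0 l : linked l 0 0.
Proof. by rewrite /linked /embed_abs !linear0. Qed.

(** The negative case is the nonnegative one for - l, Lam - m and exchanged
    vectors, as Lam - (Lam - m) = m. *)
Lemma Phi_reflection Lam m (l : int) u w b : (m <= Lam)%N -> linked l u w ->
  linked (l - (Lam%:Z - 2 * m%:Z)) (slice b (Phi q Lam%:R m l%:~R u))
    (slice b (Phi q Lam%:R (Lam - m) (- l%:~R) w)).
Proof.
move=> mL; case: l => [n|n]; rewrite /linked.
- rewrite {1}/embed_abs /= embed0 => ->.
  have -> : embed_abs (- n%:Z) w = embed n w by case: (n).
  by apply: Phi_reflection_ge0 => //; ring.
- have -> : embed_abs (- Negz n) w = w by rewrite /embed_abs /= embed0.
  rewrite /embed_abs [negpart (Negz n)]/= -!/(embed_abs _) => <-.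
  have muE : - (Negz n - (Lam%:Z - 2 * m%:Z)) =
      n.+1%:Z - Lam%:Z + 2 * (Lam - m)%N%:Z by rewrite NegzE -subzn //; ring.
  have := Phi_reflection_ge0 u b (leq_subr m Lam) muE.
  rewrite subKn // [in embed_abs (- - _)]opprK => h.
  by rewrite [(Negz n)%:~R]/(- n.+1%:R) opprK h.
Qed.

(** * Composites of intertwiners *)

Lemma PhiN_nil lam u bs :
  slice bs (PhiN q [::] lam u) = if bs == [::] then u else 0.
Proof.
apply: (@eq_linear _ _ _ (slice bs \o PhiN q [::] lam)
  (fun u => if bs == [::] then u else 0)) u => [||k].
- exact: linearP.
- by move=> a x y; case: ifP => // _; rewrite scaler0 addr0.
- by rewrite /= linextU /slice linextU /= eq_sym.
Qed.

Lemma slice_tcons b bs (Z : V ((nat * nat) * seq nat)%type) :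
  slice (b :: bs) (tcons Z) = slice b (slice bs Z).
Proof.
apply: (@eq_linear _ _ _ (slice (b :: bs) \o @tcons C) (slice b \o slice bs)) Z.
- exact: linearP.
- exact: linearP.
move=> [[i j] s] /=; rewrite /tcons linextU /slice !linextU /= eqseq_cons.
by case: (s == bs); rewrite ?andbF ?andbT ?linear0 // linextU.
Qed.

Lemma slice_tcons_nil (Z : V ((nat * nat) * seq nat)%type) :
  slice [::] (tcons Z) = 0.
Proof.
apply: (@eq_linear _ _ _ (slice [::] \o @tcons C) (fun=> 0)) Z.
- exact: linearP.
- by move=> a x y; rewrite scaler0 addr0.
by move=> [[i j] s] /=; rewrite /tcons linextU /slice linextU.
Qed.

(** The weight of the module reached by PhiN s from M_(lam-1) is
    lam - weight_drop s - 1. *)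
Definition weight_drop (s : seq (C * nat)) : C := \sum_(p <- s) (p.1 - 2 * p.2%:R).

Lemma PhiN_cons Lam m s lam u b bs :
  slice (b :: bs) (PhiN q ((Lam, m) :: s) lam u) =
  slice b (Phi q Lam m (lam - weight_drop s) (slice bs (PhiN q s lam u))).
Proof.
rewrite /= slice_tcons.
have [f ->] := linear_fun (Phi_linear Lam m (lam - weight_drop s)).
by rewrite slice_tmap.
Qed.

Lemma PhiN_cons_nil Lam m s lam u :
  slice [::] (PhiN q ((Lam, m) :: s) lam u) = 0.
Proof. exact: slice_tcons_nil. Qed.

Lemma PhiN_linear s lam : linear (PhiN q s lam).
Proof.
elim: s => [|[Lam m] s ih] a u v; first exact: linearP.
by rewrite /= ih /tcons !linearP.
Qed.

Definition int_weights (zs : seq (nat * nat)) : seq (C * nat) :=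
  [seq (p.1%:R, p.2) | p <- zs].
Definition reflect_indices (zs : seq (nat * nat)) := [seq (p.1, (p.1 - p.2)%N) | p <- zs].
Definition int_weight_drop (zs : seq (nat * nat)) : int :=
  \sum_(p <- zs) (p.1%:Z - 2 * p.2%:Z).

Lemma int_weights_cons Lam m zs :
  int_weights ((Lam, m) :: zs) = (Lam%:R, m) :: int_weights zs.
Proof. by []. Qed.

Lemma reflect_indices_cons Lam m zs :
  reflect_indices ((Lam, m) :: zs) = (Lam, (Lam - m)%N) :: reflect_indices zs.
Proof. by []. Qed.

Lemma weight_drop_int zs : weight_drop (int_weights zs) = (int_weight_drop zs)%:~R.
Proof.
rewrite /weight_drop /int_weight_drop big_map rmorph_sum; apply: eq_bigr => p _ /=.
by rewrite rmorphB rmorphM.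
Qed.

Lemma int_weight_drop_reflect zs : all (fun p => p.2 <= p.1)%N zs ->
  int_weight_drop (reflect_indices zs) = - int_weight_drop zs.
Proof.
move=> /allP h; rewrite /int_weight_drop big_map -sumrN; apply: eq_big_seq => p /h ph /=.
by rewrite -subzn //; ring.
Qed.

(** The linking relation passes through the factors one after the other, the
    intermediate weights being arbitrary integers. *)
Lemma PhiN_reflection zs (l : int) u w bs :
  all (fun p => p.2 <= p.1)%N zs -> linked l u w ->
  linked (l - int_weight_drop zs) (slice bs (PhiN q (int_weights zs) l%:~R u))
    (slice bs (PhiN q (int_weights (reflect_indices zs)) (- l%:~R) w)).
Proof.
move=> + luw; elim: zs bs => [|[Lam m] zs ih] bs.
  move=> _; rewrite -[int_weights (reflect_indices [::])]/(int_weights [::]).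
  rewrite -[int_weights [::]]/[::] !PhiN_nil /int_weight_drop big_nil subr0.
  by case: eqP => // _; exact: linked0.
case/andP=> mL azs; rewrite reflect_indices_cons !int_weights_cons.
case: bs => [|b bs].
  by rewrite !PhiN_cons_nil; exact: linked0.
rewrite !PhiN_cons !weight_drop_int int_weight_drop_reflect // rmorphN /=.
rewrite {1}/int_weight_drop big_cons -/(int_weight_drop zs) opprD addrA [l - _]addrC -addrA.
have -> : - (Lam%:Z - 2 * m%:Z) + (l - int_weight_drop zs) =
    l - int_weight_drop zs - (Lam%:Z - 2 * m%:Z).
  by rewrite addrC.
have -> : - l%:~R - - (int_weight_drop zs)%:~R = - (l - int_weight_drop zs)%:~R :> C.
  by rewrite rmorphB /=; ring.
by rewrite -rmorphB; apply: Phi_reflection => //; exact: ih.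
Qed.

Lemma PhiN_submodule zs n w bs :
  all (fun p => p.2 <= p.1)%N zs -> int_weight_drop zs = 0 ->
  slice bs (PhiN q (int_weights zs) n%:R (embed n w)) =
  embed n (slice bs (PhiN q (int_weights (reflect_indices zs)) (- n%:R) w)).
Proof.
move=> azs z0; have h : linked n%:Z (embed n w) w.
  by rewrite /linked {1}/embed_abs /= embed0; case: (n).
have := PhiN_reflection bs azs h; rewrite z0 subr0 /linked {1}/embed_abs /= embed0 => ->.
by case: (n).
Qed.

(** The coefficients of the two embeddings of << k >> are the same nonzero number
    on both sides, hence the diagonal coefficients of the operator on the
    submodule are those of the reflected operator. *)
Lemma PhiN_diag_shift zs n k bs :
  all (fun p => p.2 <= p.1)%N zs -> int_weight_drop zs = 0 ->
  (PhiN q (int_weights zs) n%:R << (k + n)%N >>)@_((k + n)%N, bs) =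
  (PhiN q (int_weights (reflect_indices zs)) (- n%:R) << k >>)@_(k, bs).
Proof.
move=> azs z0; apply: (mulfI (qpoch_neq0 k n hq)).
have [f fE] := linear_fun (PhiN_linear (int_weights zs) n%:R).
rewrite !mcoeff_slice -mcoeff_embed -PhiN_submodule // embedU.
by rewrite fE !linearZ /= mcoeffZ.
Qed.

(** This is the stability of the submodule, which makes the operator descend to
    the quotient. *)
Lemma PhiN_submodule_lt zs n k a bs : all (fun p => p.2 <= p.1)%N zs ->
  int_weight_drop zs = 0 -> (n <= k)%N -> (a < n)%N ->
  (PhiN q (int_weights zs) n%:R << k >>)@_(a, bs) = 0.
Proof.
move=> azs z0 nk an; rewrite -(subnK nk).
apply: (mulfI (qpoch_neq0 (k - n) n hq)); rewrite mulr0.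
have [f fE] := linear_fun (PhiN_linear (int_weights zs) n%:R).
have := PhiN_submodule n << (k - n)%N >> bs azs z0.
rewrite embedU fE !linearZ /= => /(congr1 (fun v => v@_a)).
by rewrite mcoeffZ -mcoeff_slice mcoeff_embed_lt.
Qed.

End Reflection.

(** * The operators on the finite-dimensional quotient *)

Section Quotient.
Variables (C : fieldType) (q : qexponential C).
Hypothesis hq : generic q.
Local Notation V I := {malg C[I]}.

Lemma projL_linear n : linear (@projL C n).
Proof. exact: linearP. Qed.

Lemma projLU n k :
  @projL C n << k >> = if insub k is Some i then << i >> else 0.
Proof. exact: linextU. Qed.

Lemma mcoeff_projL n (v : V nat) (i : 'I_n) : (projL n v)@_i = v@_(i : nat).
Proof.
rewrite /projL linextE [in RHS](monalgE v) !raddf_sum.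
apply: eq_bigr => k _ /=; rewrite mcoeffZ mcoeffU.
case: insubP => [j _ <-|kn].
  by rewrite mcoeff_basis -(inj_eq val_inj) mulr_natr.
rewrite mcoeff0 mulr0; case: eqP => // e.
by rewrite e ltn_ord in kn.
Qed.

(** The operator on the quotient is computed on representatives; it is well
    defined since the kernel of the projection is stable. *)
Lemma PhiL_is_PhiL zs n : all (fun p => p.2 <= p.1)%N zs -> int_weight_drop zs = 0 ->
  is_PhiL q (int_weights C zs) (lam := n) (@PhiL C q (int_weights C zs) n).
Proof.
move=> azs z0; have [P PE] := linear_fun (PhiN_linear q (int_weights C zs) n%:R).
have [p pE] := linear_fun (projL_linear n).
have ex : exists g, is_PhiL q (int_weights C zs) (lam := n) g.
  exists (tmap (projL n) idfun \o PhiN q (int_weights C zs) n%:R \o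
    linext (fun i : 'I_n => << (i : nat) >>)).
  split=> [|v]; first by rewrite PE; exact: linearP.
  rewrite PE pE.
  apply: (@eq_linear _ _ _ (fun v => (tmap p idfun \o P \o
    linext (fun i : 'I_n => << (i : nat) >>)) (p v)) (tmap p idfun \o P)) => [||k].
  - by move=> a x y; rewrite !linearP.
  - exact: linearP.
  rewrite -pE projLU /=; case: insubP => [l _ <-|kn].
    by rewrite linextU.
  rewrite !linear0; apply: slice_inj => cs; rewrite linear0 pE slice_tmap -pE.
  apply/malgP => l; rewrite mcoeff0 mcoeff_projL -mcoeff_slice -PE.
  by rewrite PhiN_submodule_lt // leqNgt.
exact: (@xgetPex _ (fun=> 0) [set g | is_PhiL q (int_weights C zs) g] ex).
Qed.

Lemma PhiL_mcoeff zs n (i j : 'I_n) bs :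
  all (fun p => p.2 <= p.1)%N zs -> int_weight_drop zs = 0 ->
  (PhiL q (int_weights C zs) << i >>)@_(j, bs) =
  (PhiN q (int_weights C zs) n%:R << (i : nat) >>)@_((j : nat), bs).
Proof.
move=> azs z0; have [_ /(_ << (i : nat) >>)] := PhiL_is_PhiL n azs z0.
have [P PE] := linear_fun (PhiN_linear q (int_weights C zs) n%:R).
have [p pE] := linear_fun (projL_linear n).
rewrite projLU insubT // => {}insI.
have -> : Sub (i : nat) insI = i by apply: val_inj.
move=> ->; rewrite PE pE mcoeff_slice slice_tmap -pE mcoeff_projL.
by rewrite -mcoeff_slice.
Qed.

End Quotient.

(** * Diagonal coefficients as exponential sums *)

Section EventualExponentialSums.
Variables (C : fieldType) (q : qexponential C).
Implicit Types f g : nat -> C.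

(** Finitely many values are left free: for small k a coordinate vanishes because
    its index would be negative, and not by the general formula. *)
Definition eventually_expsum f :=
  exists (K : nat) (l : seq (C * C)), forall k, (K <= k)%N ->
  f k = \sum_(p <- l) p.1 * q (p.2 * k%:R).

Lemma expsum_ext f g K : eventually_expsum f ->
  (forall k, (K <= k)%N -> f k = g k) -> eventually_expsum g.
Proof.
move=> [K' [l fE]] fg; exists (maxn K K'), l => k.
by rewrite geq_max => /andP[/fg<- /fE->].
Qed.

Lemma expsum_qpow a b : eventually_expsum (fun k => q (a + b * k%:R)).
Proof. by exists 0%N, [:: (q a, b)] => k _; rewrite big_seq1 qpowD. Qed.

Lemma expsum_cst c : eventually_expsum (fun=> c).
Proof. by exists 0%N, [:: (c, 0)] => k _; rewrite big_seq1 mul0r qpow0 mulr1. Qed.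

Lemma expsumD f g : eventually_expsum f -> eventually_expsum g ->
  eventually_expsum (fun k => f k + g k).
Proof.
move=> [K [l fE]] [K' [l' gE]]; exists (maxn K K'), (l ++ l') => k.
by rewrite geq_max => /andP[/fE-> /gE->]; rewrite big_cat.
Qed.

Lemma expsumM f g : eventually_expsum f -> eventually_expsum g ->
  eventually_expsum (fun k => f k * g k).
Proof.
move=> [K [l fE]] [K' [l' gE]].
exists (maxn K K'), [seq (p.1 * p'.1, p.2 + p'.2) | p <- l, p' <- l'] => k.
rewrite geq_max => /andP[/fE-> /gE->]; rewrite big_allpairs_dep mulr_suml.
apply: eq_bigr => p _; rewrite mulr_sumr; apply: eq_bigr => p' _ /=.
by rewrite mulrDl qpowD mulrACA.
Qed.

Lemma expsumB f g : eventually_expsum f -> eventually_expsum g ->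
  eventually_expsum (fun k => f k - g k).
Proof.
move=> ef eg; have := expsumD ef (expsumM (expsum_cst (- 1)) eg).
by move/(expsum_ext (K := 0)); apply=> k _; rewrite mulN1r.
Qed.

Lemma expsum_qnum a b : eventually_expsum (fun k => qnum q (a + b * k%:R)).
Proof.
have := expsumM (expsumB (expsum_qpow a b) (expsum_qpow (- a) (- b)))
  (expsum_cst (q 1 - q (- 1))^-1).
move/(expsum_ext (K := 0)); apply=> k _; rewrite /qnum.
by rewrite mulNr -opprD.
Qed.

Lemma expsum_qpoch m : eventually_expsum (fun k => qpoch q k.+1%:R m).
Proof.
elim: m => [|m ih].
  by move/(expsum_ext (K := 0)): (expsum_cst 1); apply=> k _; rewrite qpoch0.
move/(expsum_ext (K := 0)): (expsumM ih (expsum_qnum (1 + m%:R) 1)); apply=> k _.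
by rewrite qpochSr; congr (_ * qnum q _); rewrite -natr1; ring.
Qed.

Lemma expsum_shift f c d :
  eventually_expsum f -> eventually_expsum (fun k => f (k + c - d)%N).
Proof.
move=> [K [l fE]].
exists (K + d)%N, [seq (p.1 * q (p.2 * (c%:R - d%:R)), p.2) | p <- l] => k Kk.
rewrite fE; last by lia.
rewrite big_map; apply: eq_bigr => p _ /=; rewrite -mulrA -qpowD.
rewrite natrB ?natrD; last by lia.
by congr (_ * q _); ring.
Qed.

End EventualExponentialSums.

Section DiagonalCoefficients.
Variables (C : fieldType) (q : qexponential C).
Hypothesis hq : generic q.
Local Notation V I := {malg C[I]}.

Lemma qpow_int_inj x y : q (2 * (x%:R - y%:R)) = 1 -> x = y.
Proof.
have q2_neq1 n : q (2 * n.+1%:R) != 1.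
  apply: contra (hq n) => /eqP e; rewrite /qnum.
  have -> : q n.+1%:R = q (- n.+1%:R).
    have -> : n.+1%:R = - n.+1%:R + 2 * n.+1%:R :> C by ring.
    by rewrite qpowD e mulr1; congr (q _); ring.
  by rewrite subrr mul0r.
move=> e; have [xy|yx|//] := ltngtP x y.
- have := q2_neq1 (y - x).-1; rewrite prednK ?subn_gt0 // natrB ?(ltnW xy) //.
  have -> : 2 * (y%:R - x%:R) = - (2 * (x%:R - y%:R)) :> C by ring.
  by rewrite qpowN e invr1 eqxx.
- have := q2_neq1 (x - y).-1; rewrite prednK ?subn_gt0 // natrB ?(ltnW yx) //.
  by rewrite e eqxx.
Qed.

Lemma mcoeff_VermaK lam x (v : V nat) a :
  (opK (Verma q lam) x v)@_a = q ((lam - 2 * a%:R) * x) * v@_a.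
Proof.
rewrite [v]monalgE linear_sum !raddf_sum mulr_sumr; apply: eq_bigr => i _ /=.
have -> : << v@_i *g i >> = v@_i *: << i >> :> V nat.
  by apply/malgP => j; rewrite mcoeffZ !mcoeffU mulrnAr mulr1.
rewrite linearZ /= VermaK !mcoeffZ mcoeff_basis.
by have [->|_] := eqVneq i a; rewrite ?mulr0 // mulrCA.
Qed.

Lemma mcoeff_VermaE lam (v : V nat) a :
  (opE (Verma q lam) v)@_a = qnum q (lam - a%:R) * v@_a.+1.
Proof.
rewrite [v]monalgE linear_sum !raddf_sum mulr_sumr; apply: eq_bigr => i _ /=.
have -> : << v@_i *g i >> = v@_i *: << i >> :> V nat.
  by apply/malgP => j; rewrite mcoeffZ !mcoeffU mulrnAr mulr1.
rewrite linearZ /= VermaE !mcoeffZ mcoeff_basis; case: i => [|i]; first by rewrite mcoeff0 !mulr0.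
rewrite mcoeffZ mcoeff_basis eqSS; have [->|_] := eqVneq i a; last by rewrite !mulr0.
by rewrite mulrCA -natr1; congr (qnum q _ * _); ring.
Qed.

Lemma slice_tensK mu Lam x b (w : V (nat * nat)%type) :
  slice b (opK (tensor (Verma q mu) (dualVerma q Lam)) x w) =
  q ((Lam - 2 * b%:R) * x) *: opK (Verma q mu) x (slice b w).
Proof.
apply: (@eq_linear _ _ _ (slice b \o opK (tensor (Verma q mu) (dualVerma q Lam)) x)
  (fun w => q ((Lam - 2 * b%:R) * x) *: opK (Verma q mu) x (slice b w))) w => [||[a c]].
- exact: linearP.
- by move=> k y z; rewrite !linearP.
rewrite /= -tensU tensorK slice_tens slice_tens dualK mcoeffZ mcoeff_basis linearZ /= scalerA.
by have [->|_] := eqVneq c b; rewrite ?mulr1 // !mulr0.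
Qed.

(** The weights of both sides under K are powers of q whose exponents differ by
    twice an integer, and q is not a root of unity. *)
Lemma Phi_weight Lam m lam k a b :
  (Phi q Lam m lam << k >>)@_(a, b) != 0 -> (a + b = k + m)%N.
Proof.
have [[_ _ _ hK] _] := Phi_is_Phi hq Lam m lam; move: (hK 1 << k >>).
have [f fE] := linear_fun (Phi_linear hq Lam m lam).
rewrite VermaK fE linearZ /= -fE => /(congr1 (fun w => w@_(a, b))).
rewrite mcoeffZ [in RHS]mcoeff_slice slice_tensK mcoeffZ mcoeff_VermaK -mcoeff_slice.
rewrite mulrA => + c0 => /(mulIf c0); rewrite -qpowD !mulr1 => e.
apply/esym/qpow_int_inj; rewrite !natrD.
apply: (mulfI (qpow_neq0 q (lam - 1 - 2 * k%:R))).
by rewrite mulr1 [RHS]e -qpowD; congr (q _); ring.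
Qed.

(** A weight space of a Verma module has dimension at most one. *)
Lemma single_coord (v : V nat) B K :
  (forall j, v@_j != 0 -> (j + B = K)%N) ->
  v = if (B <= K)%N then v@_(K - B)%N *: << (K - B)%N >> else 0.
Proof.
move=> h; apply/malgP => j; have [BK|KB] := leqP B K.
  rewrite mcoeffZ mcoeff_basis; have [->|jn] := eqVneq; first by rewrite mulr1.
  rewrite mulr0; apply/eqP; apply: contraNT jn => /h e.
  by rewrite -e addnK.
rewrite mcoeff0; apply/eqP; apply: contraTT KB => /h <-.
by rewrite -leqNgt leq_addl.
Qed.

Definition index_sum (s : seq (C * nat)) : nat := \sum_(p <- s) p.2.

Lemma PhiN_weight s lam k a bs :
  (PhiN q s lam << k >>)@_(a, bs) != 0 -> (a + sumn bs = k + index_sum s)%N.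
Proof.
elim: s a bs => [|[Lam m] s ih] a bs; rewrite mcoeff_slice.
  rewrite PhiN_nil /index_sum big_nil; case: (bs =P [::]) => [->|_]; last by rewrite mcoeff0 eqxx.
  by rewrite mcoeff_basis; case: (k =P a) => [->|_]; rewrite ?eqxx //= !addn0.
case: bs => [|b bs]; first by rewrite PhiN_cons_nil mcoeff0 eqxx.
rewrite PhiN_cons // -mcoeff_slice.
rewrite (@single_coord (slice bs (PhiN q s lam << k >>))
  (sumn bs) (k + index_sum s)); last first.
  by move=> j; rewrite -mcoeff_slice; exact: ih.
set mu := lam - _; have [f fE] := linear_fun (Phi_linear hq Lam m mu).
case: leqP => [le|_]; last by rewrite fE linear0 mcoeff0 eqxx.
rewrite fE linearZ /= mcoeffZ mulf_eq0 negb_or -fE => /andP[_ /Phi_weight e].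
by rewrite /index_sum big_cons -/(index_sum s) /=; lia.
Qed.

(** By weight reasons this is the only coordinate at u_b that can be nonzero. *)
Definition Phi_coord Lam m lam b k : C :=
  (Phi q Lam m lam << k >>)@_((k + m - b)%N, b).
Definition PhiN_coord s lam bs k : C :=
  (PhiN q s lam << k >>)@_((k + index_sum s - sumn bs)%N, bs).

(** Induction on b. At u_0 the coordinate is explicit, and the E-equation solves
    for the coordinate at u_(b+1) in terms of those at u_b, with coefficients that
    are products of powers of q and quantum numbers with exponents affine in k. *)
Lemma expsum_Phi_coord Lam m lam b : eventually_expsum q (Phi_coord Lam m lam b).
Proof.
elim: b => [|b ih].
  have e1 := expsum_qpoch q m.
  have e2 := expsum_qpow q (m%:R * (lam - Lam + 2 * m%:R - m%:R)) (- Lam).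
  apply: (expsum_ext (K := 0) (expsumM e2 e1)) => k _.
  rewrite /Phi_coord mcoeff_slice slice0_Phi // subn0 [(k + m)%N]addnC mcoeffZ mcoeff_basis.
  rewrite eqxx mulr1 [(m + k)%N]addnC qfact_add [_ / _]mulrAC mulfV ?qfact_neq0 // mul1r.
  by congr (q _ * _); ring.
pose mu := lam - Lam + 2 * m%:R.
have e1 := expsumM (expsum_qnum q lam (- 1)) (expsum_shift 0 1 ih).
have e2 := expsumM (expsum_qnum q (mu - m%:R + b%:R) (- 1)) ih.
have e3 := expsum_qpow q (- (mu - 1 - 2 * (m%:R - b%:R - 1))) 2.
have e := expsumM (expsumM e3 (expsum_cst q (qnum q b.+1%:R)^-1)) (expsumB e1 e2).
apply: (expsum_ext (K := b.+2) e) => k kb; rewrite /Phi_coord addn0.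
have kE : (k.-1).+1 = k by lia.
pose a := (k + m - b.+1)%N.
have aE : (k + m - b)%N = a.+1 by rewrite /a; lia.
have aE' : (k - 1 + m - b)%N = a by rewrite /a; lia.
have aR : a%:R = k%:R + m%:R - b%:R - 1 :> C.
  by rewrite /a natrB ?natrD -?[b.+1%:R]natr1; [ring|lia].
rewrite -/a aE aE'.
have [f fE] := linear_fun (Phi_linear hq Lam m lam).
have [[_ hE _ _] _] := Phi_is_Phi hq Lam m lam; move: (hE << k >>).
have -> : opE (Verma q (lam - 1)) << k >> = qnum q (lam - k%:R) *: << k.-1 >>.
  by rewrite -{1}kE VermaE kE; congr (qnum q _ *: _); ring.
rewrite fE linearZ /= -fE => /esym.
move/(congr1 (fun w => w@_(a, b))); rewrite mcoeff_slice slice_tensE mcoeffD mcoeffZ.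
rewrite mcoeff_VermaE mcoeff_VermaK mcoeffZ -!mcoeff_slice subn1 -/mu.
set X := (Phi _ _ _ _ _)@_(a.+1, b); set Y := (Phi _ _ _ _ _)@_(a, b.+1).
set Z := (Phi _ _ _ _ << k.-1 >>)@_ _ => h.
have {h} : qnum q b.+1%:R * (q (mu - 1 - 2 * a%:R) * Y) =
    qnum q (lam + - 1 * k%:R) * Z - qnum q (mu - m%:R + b%:R + - 1 * k%:R) * X.
  move: h; rewrite mulr1 addrC => /(canRL (addrK _)) ->.
  by congr (qnum q _ * _ - qnum q _ * _); rewrite -?natr1 ?aR; ring.
move=> <-.
have -> : - (mu - 1 - 2 * (m%:R - b%:R - 1)) + 2 * k%:R = - (mu - 1 - 2 * a%:R).
  by rewrite aR; ring.
by rewrite qpowN; field; rewrite hq qpow_neq0.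
Qed.

(** Only one weight vector occurs at each intermediate step, so that a coordinate
    of a composite is a product of shifted coordinates of its factors. *)
Lemma expsum_PhiN_coord s lam bs : eventually_expsum q (PhiN_coord s lam bs).
Proof.
elim: s bs => [|[Lam m] s ih] bs.
  apply: (expsum_ext (K := 0) (expsum_cst q (bs == [::])%:R)) => k _.
  rewrite /PhiN_coord mcoeff_slice PhiN_nil /index_sum big_nil.
  case: eqP => [->|_]; last by rewrite mcoeff0.
  by rewrite addn0 subn0 mcoeff_basis eqxx.
case: bs => [|b bs].
  apply: (expsum_ext (K := 0) (expsum_cst q 0)) => k _.
  by rewrite /PhiN_coord mcoeff_slice PhiN_cons_nil mcoeff0.
set mu := lam - weight_drop s.
have e := expsumM (ih bs) (expsum_shift (index_sum s) (sumn bs) (expsum_Phi_coord Lam m mu b)).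
apply: (expsum_ext (K := sumn bs) e) => k kb.
rewrite {2}/PhiN_coord mcoeff_slice PhiN_cons // -mcoeff_slice -/mu.
rewrite (@single_coord (slice bs (PhiN q s lam << k >>))
  (sumn bs) (k + index_sum s)); last first.
  by move=> j; rewrite -mcoeff_slice; exact: PhiN_weight.
rewrite (leq_trans kb (leq_addr _ _)).
have [f fE] := linear_fun (Phi_linear hq Lam m mu).
rewrite fE linearZ /= -fE mcoeffZ -mcoeff_slice /PhiN_coord /Phi_coord.
congr (_ * (Phi _ _ _ _ _)@_(_, _)).
by rewrite /index_sum big_cons /= -/(index_sum s); lia.
Qed.

End DiagonalCoefficients.

(** * Limits of complex sequences *)

Section ComplexLimits.
Variable R : realType.
Local Notation C := R[i].
Import Normc.
Local Open Scope complex_scope.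
Implicit Types (z w : C) (u v : nat -> C).
Local Notation "u ~> l" := ((u : nat -> C^o) @ \oo --> (l : C^o))
  (at level 70).

Lemma normCE z : `|z| = (normc z)%:C.
Proof. by case: z. Qed.

Lemma ltc_norm z (r : R) : (`|z| < r%:C) = (normc z < r).
Proof. by rewrite normCE ltcR. Qed.

Lemma normc_ge0 z : 0 <= normc z.
Proof. by rewrite -ler0c -normCE. Qed.

Lemma normc_eq0 z : (normc z == 0) = (z == 0).
Proof. by apply/eqP/eqP => [/eq0_normc //|->]; rewrite normc0. Qed.

Lemma normc_gt0 z : (0 < normc z) = (z != 0).
Proof. by rewrite lt_def normc_eq0 normc_ge0 andbT. Qed.

Lemma normcX z k : normc (z ^+ k) = normc z ^+ k.
Proof. by elim: k => [|k ih]; rewrite ?expr0 ?normc1 // !exprS normcM ih. Qed.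

Lemma normcR (r : R) : normc r%:C = `|r|.
Proof. by rewrite /normc /= expr0n addr0 sqrtr_sqr. Qed.

Lemma normcB z w : normc (z - w) = normc (w - z).
Proof. by rewrite -normcN opprB. Qed.

Lemma le_normc_sum (I : Type) (s : seq I) (P : pred I) (F : I -> C) :
  normc (\sum_(i <- s | P i) F i) <= \sum_(i <- s | P i) normc (F i).
Proof.
apply: (big_ind2 (fun x y => normc x <= y)) => //; first by rewrite normc0.
by move=> x a y b xa yb; rewrite (le_trans (le_normcD _ _)) // lerD.
Qed.

Lemma le_normcBD z w : normc (z - w) <= normc z + normc w.
Proof. by rewrite -(normcN w) le_normcD. Qed.

(** The norm of C takes its values in C; with the real-valued norm the comparison
    lemmas for real sequences apply. *)
Lemma cvgcP u (l : C) :
  (u ~> l) <->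
  ((fun n => normc (u n - l)) @ \oo --> (0 : R)).
Proof.
have cvgE := @cvgrPdist_lt C (C^o : pseudoMetricNormedZmodType C) nat \oo _
  (u : nat -> C^o) l.
split=> [/cvgE ul|/cvgrPdist_lt ul].
- apply/cvgrPdist_lt => e e0.
  have e0' : 0 < e%:C :> C by rewrite ltcR.
  have := ul _ e0'; apply: filterS => n.
  by rewrite ltc_norm sub0r normrN ger0_norm ?normc_ge0 // normcB.
- apply/cvgE => e e0.
  have eR : e = (complex.Re e)%:C.
    by case: e e0 => a b; rewrite ltcE /= => /andP[/eqP -> _].
  have e0' : 0 < complex.Re e by rewrite eR ltcR in e0.
  have := ul _ e0'; apply: filterS => n.
  by rewrite eR ltc_norm sub0r normrN ger0_norm ?normc_ge0 //= normcB.
Qed.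

Lemma cvgc_squeeze u (l : C) (b : nat -> R) :
  (forall n, normc (u n - l) <= b n) -> b @ \oo --> (0 : R) ->
  u ~> l.
Proof.
move=> ub b0; apply/cvgcP.
apply: (@squeeze_cvgr _ _ _ _ (fun=> 0) b) => //; last exact: cvg_cst.
by apply: nearW => n; rewrite normc_ge0 ub.
Qed.

(** The bound is asked from rank 1 on: it is meant for the partial sums of a series
    compared with its first term, which the empty sum does not contain. *)
Lemma cvgc_normc_le u (l c : C) (B : R) :
  u ~> l -> (forall n, normc (u n.+1 - c) <= B) ->
  normc (l - c) <= B.
Proof.
move=> /cvgcP ul uB; apply/ler_addgt0Pr => e e0.
have /cvgrPdist_lt /(_ e e0) [N _ /(_ N.+1 (leqnSn N))] := ul.
rewrite /= sub0r normrN ger0_norm ?normc_ge0 // => h.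
have -> : l - c = (l - u N.+1) + (u N.+1 - c) by rewrite addrA subrK.
rewrite (le_trans (le_normcD _ _)) // addrC lerD // normcB; exact: ltW.
Qed.

Lemma cvgc_real (x : nat -> R) (l : R) :
  x @ \oo --> l -> (fun n => (x n)%:C) ~> l%:C.
Proof.
move=> xl; apply/cvgcP.
have -> : (fun n => normc ((x n)%:C - l%:C)) = (fun n => `|x n - l|).
  by apply: funext => n; rewrite -rmorphB normcR.
rewrite -(normr0 R); apply: cvg_norm; rewrite -(subrr l).
by apply: cvgB => //; exact: cvg_cst.
Qed.

Lemma cvgc_unique u (l l' : C) :
  u ~> l -> u ~> l' -> l = l'.
Proof. by move=> ul ul'; exact: (cvg_unique (@norm_hausdorff C C^o) ul ul'). Qed.

Lemma cvgc_ext u v (l : C) : u ~> l -> (\forall n \near \oo, u n = v n) -> v ~> l.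
Proof. by move=> ul uv; apply: cvg_trans ul; exact: near_eq_cvg. Qed.

Lemma cvgcD u v (l m : C) : u ~> l -> v ~> m -> (fun n => u n + v n) ~> l + m.
Proof. by move=> ul vm; exact: (@cvgD C C^o _ _ _ _ _ _ _ ul vm). Qed.

Lemma cvgcM u v (l m : C) : u ~> l -> v ~> m -> (fun n => u n * v n) ~> l * m.
Proof. by move=> ul vm; exact: (@cvgM C _ _ _ _ _ _ _ ul vm). Qed.

Lemma cvgc_cst (c : C) : (fun=> c) ~> c.
Proof. exact: cvg_cst. Qed.

Lemma cvgcZ (c : C) u (l : C) : u ~> l -> (fun n => c * u n) ~> c * l.
Proof. by move=> ul; exact: (cvgcM (@cvgc_cst c) ul). Qed.

Arguments cvgcZ c {u l}.
Arguments cvgc_cst c : clear implicits.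

Lemma cvgcB u v (l m : C) : u ~> l -> v ~> m -> (fun n => u n - v n) ~> l - m.
Proof.
move=> ul vm; have := cvgcD ul (cvgcZ (- 1) vm); rewrite mulN1r.
by move/cvgc_ext; apply; apply: nearW => n; rewrite mulN1r.
Qed.

Lemma cvgc_shift k u (l : C) : u ~> l <-> (fun n => u (n + k)%N) ~> l.
Proof. by rewrite -(@cvg_shiftn k C^o u _). Qed.

Lemma cvgc_neq0 u (l : C) : u ~> l -> l != 0 -> \forall n \near \oo, u n != 0.
Proof.
move=> /cvgcP /cvgrPdist_lt ul l0; rewrite -normc_gt0 in l0.
have := ul _ l0; apply: filterS => n; apply: contraTneq => ->.
by rewrite !sub0r normcN normrN ger0_norm ?normc_ge0 ?ltxx.
Qed.

Lemma cvgcV u (l : C) : u ~> l -> l != 0 -> (fun n => (u n)^-1) ~> l^-1.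
Proof. by move=> ul l0; exact: (@cvgV C _ _ _ _ _ l0 ul). Qed.

(** Beyond some rank a term is the difference of two partial sums within 1 of the
    limit. *)
Lemma cvgc_terms_bounded u (l : C) :
  (fun N => \sum_(k < N) u k) ~> l ->
  exists M : R, 0 < M /\ forall k, normc (u k) <= M.
Proof.
move=> /cvgcP /cvgrPdist_lt /(_ 1 ltr01) [N _ hN].
exists (\sum_(k < N) normc (u k) + 2).
split=> [|k].
  by apply: ltr_wpDl => //; apply: sumr_ge0 => i _; exact: normc_ge0.
have [kN|Nk] := ltnP k N.
  rewrite (bigD1 (Ordinal kN)) //= -addrA lerDl addr_ge0 //.
  by apply: sumr_ge0 => i _; exact: normc_ge0.
rewrite ler_wpDl //; first by apply: sumr_ge0 => i _; exact: normc_ge0.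
have h1 := hN k Nk; have h2 := hN k.+1 (leqW Nk).
rewrite /= sub0r normrN ger0_norm ?normc_ge0 // in h1.
rewrite /= sub0r normrN ger0_norm ?normc_ge0 // big_ord_recr /= in h2.
have -> : u k = (\sum_(i < k) u i + u k - l) - (\sum_(i < k) u i - l) by ring.
rewrite (le_trans (le_normcBD _ _)) //.
by apply: ltW; rewrite -[2]/(1 + 1) ltrD.
Qed.

Lemma geometric_sum_le (t : R) n : 0 <= t < 1 ->
  \sum_(k < n) t ^+ k <= (1 - t)^-1.
Proof.
move=> /andP[t0 t1]; have t1' : 0 < 1 - t by rewrite subr_gt0.
rewrite -(ler_pM2l t1') mulfV ?gt_eqF // -(opprB t) mulNr -subrX1 opprB.
by rewrite gerBl exprn_ge0.
Qed.

Lemma cvg_geometric_bound (K t : R) : 0 <= t < 1 ->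
  (fun n => K * t ^+ n) @ \oo --> (0 : R).
Proof.
move=> /andP[t0 t1]; have := @cvg_geometric R K t; rewrite ger0_norm //.
by move=> /(_ t1).
Qed.

Lemma cvgc_geometric z : normc z < 1 ->
  (fun N => \sum_(k < N) z ^+ k) ~> (1 - z)^-1.
Proof.
move=> z1; have z1' : 1 - z != 0.
  by apply: contraTneq z1 => /subr0_eq <-; rewrite normc1 ltxx.
apply: (@cvgc_squeeze _ _ (fun n => normc (1 - z)^-1 * normc z ^+ n)) => [n|].
  have -> : \sum_(k < n) z ^+ k - (1 - z)^-1 = - ((1 - z)^-1 * z ^+ n).
    apply: (mulfI z1'); rewrite mulrBr mulrN mulrA mulfV // mul1r.
    by rewrite -(opprB z) mulNr -subrX1 opprB addrAC subrr sub0r.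
  by rewrite normcN normcM normcX.
by apply: cvg_geometric_bound; rewrite normc_ge0 z1.
Qed.

(** Grouping by the first index shows the defect of the partial Cauchy product as
    a sum of tails of the second series. *)
Lemma cauchy_product_sum u v N :
  \sum_(k < N) \sum_(i < k.+1) u i * v (k - i)%N =
  \sum_(i < N) u i * \sum_(j < N - i) v j.
Proof.
elim: N => [|N ih]; first by rewrite !big_ord0.
rewrite big_ord_recr /= ih [RHS]big_ord_recr /= [in LHS]big_ord_recr /=.
rewrite addrA -big_split /=; congr (_ + _); last first.
  by rewrite subnn subSnn big_ord_recr big_ord0 /= add0r.
apply: eq_bigr => i _; rewrite -mulrDr subSn ?(ltnW (ltn_ord i)) //.
by rewrite [in RHS]big_ord_recr.
Qed.

(** In the missing terms the exponents add up to at least N. The ratio is written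
    s^2 so that half of the decay gives the factor s^N and the other half keeps the
    sum over i bounded. *)
Lemma cauchy_product_cvg0 u v (Mu Mv s : R) : 0 <= s < 1 ->
  (forall i, normc (u i) <= Mu * (s ^+ 2) ^+ i) ->
  (forall i, normc (v i) <= Mv * (s ^+ 2) ^+ i) ->
  (fun N => (\sum_(i < N) u i) * (\sum_(i < N) v i) -
     \sum_(k < N) \sum_(i < k.+1) u i * v (k - i)%N) ~> 0.
Proof.
move=> s01 uM vM; have /andP[s0 s1] := s01.
have Mu0 : 0 <= Mu.
  by have := le_trans (normc_ge0 (u 0%N)) (uM 0%N); rewrite expr0 mulr1.
have Mv0 : 0 <= Mv.
  by have := le_trans (normc_ge0 (v 0%N)) (vM 0%N); rewrite expr0 mulr1.
pose K := Mu * Mv * (1 - s)^-1 * (1 - s)^-1.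
have i0 : 0 <= (1 - s)^-1 by rewrite invr_ge0 subr_ge0 ltW.
apply: (@cvgc_squeeze _ _ (fun N => K * s ^+ N)); last exact: cvg_geometric_bound.
move=> N; rewrite subr0 cauchy_product_sum mulr_suml -sumrB.
apply: (le_trans (le_normc_sum _ _ _)).
have step (i : 'I_N) : normc (u i * \sum_(j < N) v j - u i * \sum_(j < N - i) v j)
    <= Mu * Mv * (1 - s)^-1 * s ^+ N * s ^+ i.
  have Ni := ltnW (ltn_ord i).
  rewrite -mulrBr normcM -[in \sum_(j < N) _](subnK Ni) big_split_ord /=.
  rewrite [X in X - _]addrC addrK.
  have tl : normc (\sum_(j < i) v (N - i + j)%N) <=
      Mv * s ^+ (2 * (N - i)) * (1 - s)^-1.
    apply: (le_trans (le_normc_sum _ _ _)).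
    apply: (@le_trans _ _ (\sum_(j < i) Mv * s ^+ (2 * (N - i)) * s ^+ j)).
      apply: ler_sum => j _; apply: (le_trans (vM _)).
      rewrite -exprM mulnDr exprD -!mulrA ler_wpM2l // ler_wpM2l ?exprn_ge0 //.
      by rewrite mul2n -addnn exprD ler_piMr ?exprn_ge0 ?exprn_ile1 // ltW.
    rewrite -mulr_sumr ler_wpM2l ?mulr_ge0 ?exprn_ge0 //.
    exact: geometric_sum_le.
  apply: (le_trans (ler_pM (normc_ge0 _) (normc_ge0 _) (uM i) tl)).
  rewrite -exprM.
  have -> : Mu * s ^+ (2 * i) * (Mv * s ^+ (2 * (N - i)) / (1 - s)) =
    Mu * Mv * (1 - s)^-1 * (s ^+ (2 * i) * s ^+ (2 * (N - i))) by ring.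
  rewrite -exprD -mulnDr subnKC // -!mulrA ler_wpM2l // ler_wpM2l //.
  rewrite ler_wpM2l // mul2n -addnn exprD ler_wpM2l ?exprn_ge0 //.
  by rewrite -[in leLHS](subnKC Ni) exprD ler_piMr ?exprn_ge0 ?exprn_ile1 // ltW.
apply: (le_trans (ler_sum _ (fun i _ => step i))).
rewrite -mulr_sumr /K -!mulrA ler_wpM2l // ler_wpM2l // ler_wpM2l //.
by rewrite [leRHS]mulrC ler_wpM2l ?exprn_ge0 // geometric_sum_le.
Qed.

End ComplexLimits.

Arguments cvgcZ {R} c {u l} _.
Arguments cvgc_cst {R} c.

(** * Power series *)

Section PowerSeries.
Variable R : realType.
Local Notation C := R[i].
Import Normc.
Local Open Scope complex_scope.
Implicit Types (z w : C) (a b : nat -> C) (f g : C -> C) (r : R).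
Local Notation "u ~> l" := ((u : nat -> C^o) @ \oo --> (l : C^o))
  (at level 70).

Definition power_series a r g := 0 < r /\
  forall w, normc w < r -> (fun N => \sum_(k < N) a k * w ^+ k) ~> g w.

Lemma analytic_atP f z0 :
  analytic_at f z0 <-> exists a r, power_series a r (fun w => f (z0 + w)).
Proof.
split=> -[a [r [r0 h]]]; exists a, r; split=> // z zr.
- have := h (z0 + z); rewrite ltc_norm [z0 + z]addrC addrK => /(_ zr).
  exact.
- have e : z0 + (z - z0) = z by rewrite addrC subrK.
  by have := h (z - z0); rewrite e -ltc_norm => /(_ zr).
Qed.

Lemma power_series_bound a r g : power_series a r g ->
  exists M rho : R, [/\ 0 < M, 0 < rho, rho < r &
    forall k, normc (a k) * rho ^+ k <= M].
Proof.
move=> [r0 h]; have rr : 0 < r / 2 by rewrite divr_gt0.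
have rr2 : r / 2 < r by rewrite gtr_pMr // invf_lt1 // ltr1n.
have := h (r / 2)%:C; rewrite normcR gtr0_norm // => /(_ rr2).
move=> /(@cvgc_terms_bounded _ (fun k => a k * (r / 2)%:C ^+ k))[M [M0 hM]].
exists M, (r / 2); split=> // k.
by have := hM k; rewrite normcM normcX normcR gtr0_norm.
Qed.

(** A quarter of the radius at which the terms are bounded gives the ratio
    (1/2)^2 required by the estimate of Cauchy products. *)
Lemma quarter_bound a (M rho : R) w : 0 < rho ->
  (forall k, normc (a k) * rho ^+ k <= M) -> normc w < rho / 4 ->
  forall k, normc (a k * w ^+ k) <= M * (2^-1 ^+ 2) ^+ k.
Proof.
move=> r0 aM wr k; rewrite normcM normcX.
have -> : (2^-1 ^+ 2 : R) = 4^-1 by rewrite exprVn -natrX.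
apply: (@le_trans _ _ (normc (a k) * (rho / 4) ^+ k)).
  rewrite ler_wpM2l ?normc_ge0 //.
  by apply: lerXn2r; rewrite ?nnegrE ?normc_ge0 ?divr_ge0 // ltW.
by rewrite expr_div_n exprVn mulrA ler_wpM2r // invr_ge0 exprn_ge0.
Qed.

Lemma half_range : 0 <= (2^-1 : R) < 1.
Proof. by rewrite invr_ge0 invf_lt1 ?ltr1n //= ler0n. Qed.

Lemma power_seriesM a b r r' f g : power_series a r f -> power_series b r' g ->
  exists r'', power_series (fun k => \sum_(i < k.+1) a i * b (k - i)%N) r''
    (fun w => f w * g w).
Proof.
move=> psa psb.
have [M [rho [M0 rho0 rhor aM]]] := power_series_bound psa.
have [M' [rho' [M'0 rho'0 rho'r bM]]] := power_series_bound psb.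
exists (Order.min rho rho' / 4); split.
  by rewrite divr_gt0 // lt_min rho0.
move=> w wr; have wr1 : normc w < rho / 4.
  by apply: (lt_le_trans wr); rewrite ler_pM2r ?invr_gt0 // ge_min lexx.
have wr2 : normc w < rho' / 4.
  by apply: (lt_le_trans wr); rewrite ler_pM2r ?invr_gt0 // ge_min lexx orbT.
have l4 (x : R) : 0 < x -> x / 4 < x.
  by move=> x0; rewrite gtr_pMr // invf_lt1 // ltr1n.
have := cauchy_product_cvg0 half_range (quarter_bound rho0 aM wr1)
  (quarter_bound rho'0 bM wr2).
have fw := psa.2 w (lt_trans wr1 (lt_trans (l4 _ rho0) rhor)).
have gw := psb.2 w (lt_trans wr2 (lt_trans (l4 _ rho'0) rho'r)).
move=> h; have := cvgcB (cvgcM fw gw) h; rewrite subr0.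
move/cvgc_ext; apply; apply: nearW => N.
rewrite opprB addrC subrK; apply: eq_bigr => k _.
rewrite mulr_suml; apply: eq_bigr => i _.
by rewrite mulrACA -exprD subnKC // (ltnSE (ltn_ord i)).
Qed.

Lemma power_seriesZD a b r r' f g c : power_series a r f ->
  power_series b r' g ->
  exists r'', power_series (fun k => c * a k + b k) r''
    (fun w => c * f w + g w).
Proof.
move=> [r0 ha] [r'0 hb]; exists (Order.min r r'); split.
  by rewrite lt_min r0.
move=> w; rewrite lt_min => /andP[wr wr'].
have := cvgcD (cvgcZ c (ha w wr)) (hb w wr').
move/cvgc_ext; apply; apply: nearW => N.
rewrite mulr_sumr -big_split; apply: eq_bigr => k _ /=.
by rewrite mulrDl mulrA.
Qed.

(** The coefficients of B / A. The recursion refers to all earlier values, hence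
    the construction of the list of the first n of them. *)
Fixpoint quot_coefs a b n : seq C :=
  if n is n'.+1 then
    let s := quot_coefs a b n' in
    rcons s ((b n' - \sum_(i < n') a (n' - i)%N * s`_i) / a 0%N)
  else [::].
Definition quot_coef a b n : C := (quot_coefs a b n.+1)`_n.

Lemma size_quot_coefs a b n : size (quot_coefs a b n) = n.
Proof. by elim: n => //= n ih; rewrite size_rcons ih. Qed.

Lemma nth_quot_coefs a b n i : (i < n)%N ->
  (quot_coefs a b n)`_i = quot_coef a b i.
Proof.
elim: n => // n ih; rewrite ltnS leq_eqVlt => /predU1P[->//|lin].
by rewrite /= nth_rcons size_quot_coefs lin ih.
Qed.

Lemma quot_coefE a b n : quot_coef a b n =
  (b n - \sum_(i < n) a (n - i)%N * quot_coef a b i) / a 0%N.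
Proof.
rewrite {1}/quot_coef /= nth_rcons size_quot_coefs ltnn eqxx.
by congr ((_ - _) / _); apply: eq_bigr => i _; rewrite nth_quot_coefs.
Qed.

Lemma quot_coef_conv a b n : a 0%N != 0 ->
  \sum_(i < n.+1) quot_coef a b i * a (n - i)%N = b n.
Proof.
move=> a0; rewrite big_ord_recr /= subnn quot_coefE divfK //.
under eq_bigr do rewrite mulrC.
by rewrite addrC subrK.
Qed.

(** The radius shrinks by a factor t chosen such that the sum of M t^k over k > 0
    is at most |a 0| / 2; half of the bound K is then left for the term b k. *)
Lemma quot_coef_bound a b (M rho : R) : a 0%N != 0 -> 0 < M -> 0 < rho ->
  (forall k, normc (a k) * rho ^+ k <= M) ->
  (forall k, normc (b k) * rho ^+ k <= M) ->
  exists K sigma : R, [/\ 0 < sigma, sigma <= rho &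
    forall k, normc (quot_coef a b k) * sigma ^+ k <= K].
Proof.
move=> a0 M0 r0 aM bM.
have n0 : 0 < normc (a 0%N) by rewrite normc_gt0.
set A := normc (a 0%N) in n0.
(* t <= 1/2 bounds the geometric sum by 2 t, and 2 t M <= A / 2. *)
pose t := Order.min 2^-1 (A / (4 * M)).
have t0 : 0 < t by rewrite lt_min invr_gt0 ltr0n divr_gt0 // mulr_gt0.
have t2 : t <= 2^-1 by rewrite ge_min lexx.
have tA : t <= A / (4 * M) by rewrite ge_min lexx orbT.
have t1 : t <= 1 by rewrite (le_trans t2) // invf_le1 // ler1n.
exists (2 * M / A), (t * rho); split; [by rewrite mulr_gt0|by rewrite ger_pMl|].
move=> k; elim/ltn_ind: k => k ih.
rewrite quot_coefE normcM normcV -/A mulrAC ler_pM2r ?invr_gt0 //.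
have trk : 0 <= (t * rho) ^+ k by rewrite exprn_ge0 // mulr_ge0 // ltW.
apply: (@le_trans _ _ (normc (b k) * (t * rho) ^+ k +
  \sum_(i < k) normc (a (k - i)%N * quot_coef a b i) * (t * rho) ^+ k)).
  rewrite -mulr_suml -mulrDl ler_wpM2r // (le_trans (le_normcBD _ _)) //.
  by rewrite lerD // le_normc_sum.
have -> : 2 * M = M + M by rewrite mulr_natl mulr2n.
apply: lerD.
  rewrite exprMn mulrCA (le_trans _ (bM k)) // ler_piMl //.
    by rewrite mulr_ge0 ?normc_ge0 // exprn_ge0 // ltW.
  by rewrite exprn_ile1 // ltW.
have step (i : 'I_k) : normc (a (k - i)%N * quot_coef a b i) * (t * rho) ^+ k
    <= M * (2 * M / A) * t ^+ (k - i).
  have ik := ltnW (ltn_ord i).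
  rewrite -[in X in _ * X <= _](subnK ik) exprD normcM [(t * rho) ^+ (k - i)]exprMn.
  set p := t ^+ (k - i); set q := rho ^+ (k - i); set x := (t * rho) ^+ i.
  have -> : normc (a (k - i)%N) * normc (quot_coef a b i) * (p * q * x) =
    normc (a (k - i)%N) * q * (normc (quot_coef a b i) * x) * p by ring.
  rewrite ler_wpM2r ?exprn_ge0 ?(ltW t0) // ler_pM ?ih ?aM //.
  - by rewrite mulr_ge0 ?normc_ge0 // exprn_ge0 // ltW.
  - by rewrite mulr_ge0 ?normc_ge0 // exprn_ge0 // mulr_ge0 // ltW.
apply: (le_trans (ler_sum _ (fun i _ => step i))).
rewrite -mulr_sumr (reindex_inj rev_ord_inj) /=.
have -> : \sum_(j < k) t ^+ (k - (k - j.+1)) = t * \sum_(j < k) t ^+ j.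
  rewrite mulr_sumr; apply: eq_bigr => j _.
  by rewrite subKn // exprS.
have t01 : 0 <= t < 1 by rewrite ltW //= (le_lt_trans t2) // invf_lt1 // ltr1n.
apply: (@le_trans _ _ (M * (2 * M / A) * (t * 2))).
  have MA : 0 <= M * (2 * M / A) by rewrite mulr_ge0 ?divr_ge0 ?mulr_ge0 // ltW.
  rewrite (ler_wpM2l MA) // ler_wpM2l ?(ltW t0) // (le_trans (geometric_sum_le _ t01)) //.
  rewrite -[leRHS]invrK lef_pV2 ?posrE ?invr_gt0 // ?subr_gt0 ?(andP t01).2 //.
  by rewrite lerBrDr -lerBrDl (le_trans t2) //; lra.
apply: (@le_trans _ _ (M * (2 * M / A) * (A / (4 * M) * 2))).
  have MA : 0 <= M * (2 * M / A) by rewrite mulr_ge0 ?divr_ge0 ?mulr_ge0 // ltW.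
  by rewrite (ler_wpM2l MA) // ler_wpM2r.
rewrite le_eqVlt; apply/orP; left; apply/eqP; field.
by rewrite !gt_eqF.
Qed.


(** For |w| below rho / 4 the terms after the first are dominated by a geometric
    series of ratio less than 1/4. *)
Lemma power_series_near0 a r f : power_series a r f ->
  f 0 = a 0%N /\ exists M rho : R, [/\ 0 < M, 0 < rho &
    forall w, normc w < rho -> normc (f w - a 0%N) <= M * normc w].
Proof.
move=> psa; have [M [rho [M0 rho0 rhor aM]]] := power_series_bound psa.
have near w : normc w < rho / 4 -> normc (f w - a 0%N) <= 2 * M / rho * normc w.
  move=> wr; have w0 := normc_ge0 w.
  have wr' : normc w < r.
    apply: (lt_trans wr); apply: lt_trans rhor.
    by rewrite gtr_pMr // invf_lt1 // ltr1n.
  apply: (cvgc_normc_le (psa.2 w wr')) => N.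
  have B0 : 0 <= 2 * M / rho * normc w.
    by rewrite mulr_ge0 // divr_ge0 ?mulr_ge0 // ltW.
  pose t : R := normc w / rho.
  have t0 : 0 <= t by rewrite divr_ge0 // ltW.
  have t4 : t < 4^-1 by rewrite ltr_pdivrMr // mulrC.
  have t01 : 0 <= t < 1 by rewrite t0 /= (lt_trans t4) // invf_lt1 // ltr1n.
  rewrite big_ord_recl expr0 mulr1 [a 0%N + _]addrC addrK.
  apply: (le_trans (le_normc_sum _ _ _)).
  apply: (@le_trans _ _ (\sum_(i < N) M * t * t ^+ i)).
    apply: ler_sum => i _; rewrite normcM normcX -mulrA -exprS.
    have -> : normc w = rho * t by rewrite mulrC divfK // gt_eqF.
    by rewrite exprMn mulrA ler_wpM2r ?exprn_ge0.
  rewrite -mulr_sumr.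
  have -> : 2 * M / rho * normc w = M * t * 2 by rewrite /t; ring.
  apply: ler_wpM2l; first by rewrite mulr_ge0 // ltW.
  apply: (le_trans (geometric_sum_le _ t01)).
  rewrite -[leRHS]invrK lef_pV2 ?posrE ?invr_gt0 // ?subr_gt0 ?(andP t01).2 //.
  by lra.
split; last first.
  exists (2 * M / rho), (rho / 4); split=> //; first by rewrite !(divr_gt0, mulr_gt0).
  by rewrite divr_gt0.
have := near 0; rewrite normc0 mulr0 divr_gt0 // => /(_ isT) h.
by apply/eqP; rewrite -subr_eq0 -normc_eq0 eq_le h normc_ge0.
Qed.

(** The convergence of the quotient series comes for free: by the estimate of
    Cauchy products its partial sums times those of f tend to g, and those of f
    tend to a nonzero limit. *)
Lemma power_series_div a b r r' f g : a 0%N != 0 ->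
  power_series a r f -> power_series b r' g ->
  exists r'', power_series (quot_coef a b) r'' (fun w => g w / f w).
Proof.
move=> a0 psa psb.
have [M [rho [M0 rho0 rhor aM]]] := power_series_bound psa.
have [M' [rho' [M'0 rho'0 rho'r bM]]] := power_series_bound psb.
pose P := Order.min rho rho'; pose B := Order.max M M'.
have P0 : 0 < P by rewrite lt_min rho0.
have Pr : P <= rho by rewrite ge_min lexx.
have Pr' : P <= rho' by rewrite ge_min lexx orbT.
have le_bound (c : nat -> C) (m s : R) : P <= s ->
    (forall k, normc (c k) * s ^+ k <= m) -> m <= B ->
    forall k, normc (c k) * P ^+ k <= B.
  move=> Ps cm mB k; apply: le_trans mB; apply: le_trans (cm k).
  rewrite ler_wpM2l ?normc_ge0 //.
  by apply: lerXn2r; rewrite ?nnegrE // ltW // (lt_le_trans P0).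
have aB := le_bound _ _ _ Pr aM _; have bB := le_bound _ _ _ Pr' bM _.
have {}aB := aB (ltac:(by rewrite le_max lexx)).
have {}bB := bB (ltac:(by rewrite le_max lexx orbT)).
have B0 : 0 < B by rewrite lt_max M0.
have [K [sg [sg0 sgP gK]]] := quot_coef_bound a0 B0 P0 aB bB.
have [f0 [D [d [D0 d0 fD]]]] := power_series_near0 psa.
have n0 : 0 < normc (a 0%N) by rewrite normc_gt0.
pose r'' := Order.min (sg / 4) (Order.min d (normc (a 0%N) / D)).
exists r''; split.
  by rewrite !lt_min d0 !divr_gt0.
move=> w; rewrite !lt_min => /and3P[wsg wd wD].
have l4 (x : R) : 0 < x -> x / 4 < x.
  by move=> x0; rewrite gtr_pMr // invf_lt1 // ltr1n.
have wP : normc w < P / 4.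
  by apply: (lt_le_trans wsg); rewrite ler_pM2r // invr_gt0.
have wr : normc w < r.
  by rewrite (lt_trans (lt_le_trans (lt_trans wP (l4 _ P0)) Pr)).
have wr' : normc w < r'.
  by rewrite (lt_trans (lt_le_trans (lt_trans wP (l4 _ P0)) Pr')).
have fw0 : f w != 0.
  have := fD w wd; apply: contraTneq => ->.
  by rewrite sub0r normcN -ltNge mulrC -ltr_pdivlMr.
have fw := psa.2 w wr; have gw := psb.2 w wr'.
have := cauchy_product_cvg0 half_range (quarter_bound sg0 gK wsg)
  (quarter_bound P0 aB wP).
have -> : (fun N => (\sum_(i < N) quot_coef a b i * w ^+ i) *
      (\sum_(i < N) a i * w ^+ i) - \sum_(k < N) \sum_(i < k.+1)
      quot_coef a b i * w ^+ i * (a (k - i)%N * w ^+ (k - i))) =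
    (fun N => (\sum_(i < N) quot_coef a b i * w ^+ i) *
      (\sum_(i < N) a i * w ^+ i) - \sum_(k < N) b k * w ^+ k).
  apply: funext => N; congr (_ - _); apply: eq_bigr => k _.
  rewrite -(quot_coef_conv b k a0) mulr_suml; apply: eq_bigr => i _.
  by rewrite mulrACA -exprD subnKC // (ltnSE (ltn_ord i)).
move=> h; have := cvgcM (cvgcD h gw) (cvgcV fw fw0); rewrite add0r.
move/cvgc_ext; apply; have := cvgc_neq0 fw fw0; apply: filterS => N A0.
by rewrite subrK mulfK.
Qed.

Lemma power_series_shift a r g N : power_series a r g ->
  (forall k, (k < N)%N -> a k = 0) ->
  exists g', power_series (fun k => a (k + N)%N) r g' /\
    forall w, normc w < r -> g w = w ^+ N * g' w.
Proof.
move=> psa aN; have [g0 _] := power_series_near0 psa; have [r0 h] := psa.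
exists (fun w => if w == 0 then a N else g w / w ^+ N); split; last first.
  move=> w wr; have [->|w0] := eqVneq w 0; last by rewrite mulrC divfK ?expf_neq0.
  by rewrite g0; case: N aN => [|N] aN; rewrite ?expr0 ?mul1r // expr0n mul0r aN.
split; first exact: r0.
move=> w wr; have [->|w0] := eqVneq w 0.
  apply/(cvgc_shift 1); have := cvgc_cst (a N); move/cvgc_ext; apply.
  apply: nearW => n; rewrite addn1 big_ord_recl big1 ?addr0 ?expr0 ?mulr1 //.
  by move=> i _; rewrite exprS mul0r mulr0.
have := cvgcZ (w ^+ N)^-1 ((cvgc_shift N _ _).1 (h w wr)); rewrite mulrC.
move/cvgc_ext; apply; apply: nearW => n.
rewrite addnC big_split_ord /= big1 ?add0r; last by move=> i _; rewrite aN ?mul0r.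
rewrite mulr_sumr; apply: eq_bigr => i _.
by rewrite exprD addnC mulrCA mulKf ?expf_neq0.
Qed.

Lemma power_series_eq0 a r g w : power_series a r g -> (forall k, a k = 0) ->
  normc w < r -> g w = 0.
Proof.
move=> psa a0 wr; apply: (cvgc_unique (psa.2 w wr)).
have := @cvgc_cst R 0; move/cvgc_ext; apply; apply: nearW => n.
by rewrite big1 // => i _; rewrite a0 mul0r.
Qed.

(** * Analytic functions *)

(** Either all coefficients vanish, or the first nonzero one gives the order of the
    zero. *)
Lemma analytic_dichotomy f z0 : analytic_at f z0 ->
  (exists2 r, 0 < r & forall z, normc (z - z0) < r -> f z = 0) \/
  (exists N g r, [/\ 0 < r, analytic_at g z0, g z0 != 0 &
     forall z, normc (z - z0) < r -> f z = (z - z0) ^+ N * g z]).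
Proof.
move=> /analytic_atP[a [r psa]]; have r0 := psa.1.
have zE z : z0 + (z - z0) = z by rewrite addrC subrK.
have [a0|/existsNP ex] := pselect (forall k, a k = 0).
  left; exists r => // z zr; rewrite -[z]zE.
  exact: (power_series_eq0 psa).
right; have ex' : exists k, a k != 0 by case: ex => k /eqP; exists k.
case: (ex_minnP ex') => N aN minN.
have [|g' [psg gE]] := power_series_shift psa (N := N).
  by move=> k kN; apply: contraTeq kN => /minN; rewrite -leqNgt.
have [g0 _] := power_series_near0 psg.
exists N, (fun z => g' (z - z0)), r; split=> //.
- apply/analytic_atP; exists (fun k => a (k + N)%N), r.
  have -> : (fun w => g' (z0 + w - z0)) = g'; last by [].
  by apply: funext => w; rewrite addrC addKr.
- by rewrite subrr g0.
- by move=> z zr; rewrite -gE // zE.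
Qed.

Lemma analytic_continuous f z0 : analytic_at f z0 -> forall e : R, 0 < e ->
  exists2 d : R, 0 < d & forall z, normc (z - z0) < d -> normc (f z - f z0) < e.
Proof.
move=> /analytic_atP[a [r /power_series_near0[]]]; rewrite addr0 => -> [M [d]].
move=> [M0 d0 fd] e e0; exists (Order.min d (e / M)).
  by rewrite lt_min d0 divr_gt0.
move=> z; rewrite lt_min => /andP[zd ze].
have e1 : z0 + (z - z0) = z by rewrite addrC subrK.
have := fd _ zd; rewrite e1 => /le_lt_trans; apply.
by rewrite mulrC -ltr_pdivlMr.
Qed.

Lemma analytic_neq0_near f z0 : analytic_at f z0 -> f z0 != 0 ->
  exists2 d : R, 0 < d & forall z, normc (z - z0) < d -> f z != 0.
Proof.
move=> fa f0; rewrite -normc_gt0 in f0.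
have [d d0 fd] := analytic_continuous fa f0; exists d => // z /fd.
by apply: contraTneq => ->; rewrite sub0r normcN ltxx.
Qed.

Lemma analytic_ext_near f g z0 : analytic_at f z0 ->
  (exists2 d : R, 0 < d & forall z, normc (z - z0) < d -> f z = g z) ->
  analytic_at g z0.
Proof.
move=> [a [r [r0 fa]]] [d d0 fg]; exists a, (Order.min r d); split.
  by rewrite lt_min r0.
move=> z; rewrite ltc_norm lt_min => /andP[zr zd].
by rewrite -fg //; apply: fa; rewrite ltc_norm.
Qed.

Lemma analytic_cst c z0 : analytic_at (fun=> c) z0.
Proof.
exists (fun k => if k is 0%N then c else 0), 1; split=> // z _.
apply/(cvgc_shift 1); have := cvgc_cst c; move/cvgc_ext; apply.
apply: nearW => n; rewrite addn1 big_ord_recl big1 ?addr0 ?expr0 ?mulr1 //.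
by move=> i _; rewrite mul0r.
Qed.

Lemma analytic_id c z0 : analytic_at (fun z => z - c) z0.
Proof.
exists (fun k => if k is 0%N then z0 - c else (k == 1%N)%:R), 1; split=> // z _.
apply/(cvgc_shift 2); have := cvgc_cst (z - c); move/cvgc_ext; apply.
apply: nearW => n; rewrite addn2 !big_ord_recl big1 ?addr0 /=.
  by rewrite expr0 expr1; ring.
by move=> i _; rewrite mul0r.
Qed.

Lemma analyticZD f g c z0 : analytic_at f z0 -> analytic_at g z0 ->
  analytic_at (fun z => c * f z + g z) z0.
Proof.
move=> /analytic_atP[a [r psa]] /analytic_atP[b [r' psb]].
have [r'' ps] := power_seriesZD c psa psb.
by apply/analytic_atP; eexists; exists r''; exact: ps.
Qed.

Lemma analyticM f g z0 : analytic_at f z0 -> analytic_at g z0 ->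
  analytic_at (fun z => f z * g z) z0.
Proof.
move=> /analytic_atP[a [r psa]] /analytic_atP[b [r' psb]].
have [r'' ps] := power_seriesM psa psb.
by apply/analytic_atP; eexists; exists r''; exact: ps.
Qed.

Lemma analyticX f n z0 : analytic_at f z0 -> analytic_at (fun z => f z ^+ n) z0.
Proof.
move=> fa; elim: n => [|n ih]; first exact: analytic_cst.
have -> : (fun z => f z ^+ n.+1) = (fun z => f z * f z ^+ n).
  by apply: funext => z; rewrite exprS.
exact: analyticM.
Qed.

Lemma analytic_div f g z0 : analytic_at f z0 -> analytic_at g z0 -> g z0 != 0 ->
  analytic_at (fun z => f z / g z) z0.
Proof.
move=> /analytic_atP[b [r' psb]] /analytic_atP[a [r psa]] g0.
have [ga0 _] := power_series_near0 psa; rewrite addr0 in ga0.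
rewrite ga0 in g0; have [r'' ps] := power_series_div g0 psa psb.
by apply/analytic_atP; eexists; exists r''; exact: ps.
Qed.

End PowerSeries.

(** * The identity theorem and quotients of entire functions *)

Section Meromorphic.
Variable R : realType.
Local Notation C := R[i].
Import Normc.
Local Open Scope complex_scope.
Implicit Types (z w : C) (f g h P Q : C -> C) (A B : C -> Prop).

Definition punctured_near A z : Prop := exists2 r : R, 0 < r &
  forall w, w != z -> normc (w - z) < r -> A w.

Lemma punctured_imp A B z : (forall w, A w -> B w) ->
  punctured_near A z -> punctured_near B z.
Proof. by move=> AB [r r0 rA]; exists r => // w wz /(rA _ wz)/AB. Qed.

Lemma punctured_and A B z : punctured_near A z -> punctured_near B z ->
  punctured_near (fun w => A w /\ B w) z.
Proof.
move=> [r r0 rA] [s s0 sB]; exists (Order.min r s); first by rewrite lt_min r0.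
by move=> w wz; rewrite lt_min => /andP[/(rA _ wz) Aw /(sB _ wz) Bw].
Qed.

Lemma punctured_neq z : punctured_near (fun w => w != z) z.
Proof. by exists 1. Qed.

Lemma punctured_inhabited A z : punctured_near A z -> forall e : R, 0 < e ->
  exists w, [/\ w != z, normc (w - z) < e & A w].
Proof.
move=> [r r0 rA] e e0; pose d := Order.min r e / 2.
have m0 : 0 < Order.min r e by rewrite lt_min r0.
have d0 : 0 < d by rewrite divr_gt0.
have dm : d < Order.min r e by rewrite gtr_pMr // invf_lt1 // ltr1n.
have wz : z + d%:C != z by rewrite -subr_eq0 addrC addKr -normc_eq0 normcR normr_eq0 gt_eqF.
exists (z + d%:C); move: dm; rewrite lt_min => /andP[dr de].
have nE : normc (z + d%:C - z) = d by rewrite addrC addKr normcR gtr0_norm.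
by split=> //; [rewrite nE|apply: rA => //; rewrite nE].
Qed.

(** Properties that hold on a punctured disc are propagated to the nearby points
    without expanding the power series again at these points. *)
Lemma punctured_open A z : punctured_near A z ->
  exists2 d : R, 0 < d & forall w, normc (w - z) < d -> punctured_near A w.
Proof.
move=> [r r0 rA]; exists r => // w wr.
have [->|wz] := eqVneq w z; first by exists r.
exists (Order.min (normc (w - z)) (r - normc (w - z))).
  by rewrite lt_min subr_gt0 wr normc_gt0 subr_eq0 wz.
move=> u uw; rewrite lt_min => /andP[u1 u2]; apply: rA.
  by apply: contraTneq u1 => ->; rewrite normcB ltxx.
have -> : u - z = (u - w) + (w - z) by rewrite addrA subrK.
by rewrite (le_lt_trans (le_normcD _ _)) // -ltrBrDr.
Qed.

Lemma meromorphic_germ f z : meromorphic f ->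
  exists N g, analytic_at g z /\ punctured_near (fun w => f w = g w / (w - z) ^+ N) z.
Proof.
move=> /(_ z)[fa|[N [g [r [_ ga _ r0 fE]]]]].
  by exists 0%N, f; split=> //; exists 1 => // w _ _; rewrite expr0 divr1.
exists N, g; split=> //; exists r => // w wz wr; apply: fE.
by rewrite ltc_norm wr normr_gt0 subr_eq0 wz.
Qed.

(** After multiplication by a power of w - z the difference becomes analytic at z,
    and the zeros of an analytic function are isolated unless it vanishes near z. *)
Lemma meromorphic_dichotomy f h z : meromorphic f -> meromorphic h ->
  punctured_near (fun w => f w = h w) z \/ punctured_near (fun w => f w != h w) z.
Proof.
move=> /(meromorphic_germ z)[N [g [ga fE]]] /(meromorphic_germ z)[N' [g' [ga' hE]]].
pose d : C -> C := fun w => - 1 * (g' w * (w - z) ^+ N) + g w * (w - z) ^+ N'.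
have da : analytic_at d z.
  apply: analyticZD.
    exact: (analyticM ga' (analyticX N (analytic_id z z))).
  exact: (analyticM ga (analyticX N' (analytic_id z z))).
have dE : punctured_near (fun w => f w - h w = d w / (w - z) ^+ (N + N')) z.
  apply: punctured_imp (punctured_and (punctured_neq z) (punctured_and fE hE)).
  move=> w [wz [-> ->]]; have wz0 : w - z != 0 by rewrite subr_eq0.
  by rewrite /d exprD; field; rewrite !expf_neq0.
have [[r r0 d0]|[k [g1 [r [r0 ga1 g10 dg]]]]] := analytic_dichotomy da.
  left; have dz : punctured_near (fun w => d w = 0) z by exists r => // w _ /d0.
  apply: punctured_imp (punctured_and dE dz) => w [e e0].
  by apply/eqP; rewrite -subr_eq0 e e0 mul0r.
right; have [s s0 g1n] := analytic_neq0_near ga1 g10.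
have dn : punctured_near (fun w => d w != 0) z.
  exists (Order.min r s); first by rewrite lt_min r0.
  move=> w wz; rewrite lt_min => /andP[/dg-> /g1n wn].
  by rewrite mulf_neq0 // expf_neq0 // subr_eq0.
apply: punctured_imp (punctured_and (punctured_neq z) (punctured_and dE dn)).
move=> w [wz [e dw]]; rewrite -subr_eq0 e mulf_neq0 // invr_eq0 expf_neq0 //.
by rewrite subr_eq0.
Qed.

Lemma open_punctured_line A z0 u :
  open [set t : R | punctured_near A (z0 + t%:C * u)].
Proof.
rewrite openE => t /= /punctured_open[d d0 dA].
have u0 : 0 < 1 + normc u by rewrite ltr_pwDl // normc_ge0.
apply/nbhs_ballP; exists (d / (1 + normc u)); first by rewrite /= divr_gt0.
move=> s; rewrite /ball /= => ts; apply: dA.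
have -> : z0 + s%:C * u - (z0 + t%:C * u) = (s - t)%:C * u.
  by rewrite rmorphB /=; ring.
rewrite normcM normcR distrC; move: ts; rewrite ltr_pdivlMr //; apply: le_lt_trans.
by rewrite ler_wpM2l // lerDr.
Qed.

(** On the line through z0 and z1 the points near which f and h agree form an open
    set, and so does its complement by the dichotomy; a segment is connected. *)
Lemma identity_theorem f h z0 z1 : meromorphic f -> meromorphic h ->
  punctured_near (fun w => f w = h w) z0 -> punctured_near (fun w => f w = h w) z1.
Proof.
move=> fm hm e0; pose u := z1 - z0.
pose S := [set t : R | punctured_near (fun w => f w = h w) (z0 + t%:C * u)].
pose S' := [set t : R | punctured_near (fun w => f w != h w) (z0 + t%:C * u)].
have S0 : S 0 by rewrite /S /= mul0r addr0.
have SC : ~` S' = S.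
  apply/seteqP; split=> t /=.
    by have [//|//] := meromorphic_dichotomy (z0 + t%:C * u) fm hm.
  move=> St S't; have [w [_ _ [e]]] := punctured_inhabited (punctured_and St S't) ltr01.
  by rewrite e eqxx.
have := @segment_connected R 0 1.
move=> /(_ (`[0, 1] `&` S)); rewrite -/(_ `&` S) => con.
suff: (1 : R) \in `[0, 1] `&` S.
  by rewrite inE => -[_]; rewrite /S /= mul1r /u addrC subrK.
rewrite con ?inE /= ?in_itv /= ?lexx ?ler01 //.
- by exists 0; split=> //=; rewrite in_itv /= lexx ler01.
- by exists S => //; exact: open_punctured_line.
- by exists S => //; rewrite -SC; apply: open_closedC; exact: open_punctured_line.
Qed.

Lemma analytic_eq f h z : analytic_at f z -> analytic_at h z ->
  punctured_near (fun w => f w = h w) z -> f z = h z.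
Proof.
move=> fa ha e; apply/eqP; rewrite -subr_eq0 -normc_eq0; apply/negPn/negP => n0.
have {}n0 : 0 < normc (f z - h z) by rewrite lt_def n0 normc_ge0.
have e2 : 0 < normc (f z - h z) / 2 by rewrite divr_gt0.
have [d d0 fd] := analytic_continuous fa e2.
have [d' d'0 hd] := analytic_continuous ha e2.
have m0 : 0 < Order.min d d' by rewrite lt_min d0.
have [w [_ wm ew]] := punctured_inhabited e m0.
move: wm; rewrite lt_min => /andP[/fd fw /hd hw].
have : normc (f z - h z) < normc (f z - h z) / 2 + normc (f z - h z) / 2.
  rewrite [in ltLHS](_ : f z - h z = - (f w - f z) + (h w - h z)).
    by apply: (le_lt_trans (le_normcD _ _)); rewrite normcN; exact: ltrD.
  by rewrite ew; ring.
by rewrite -splitr ltxx.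
Qed.

Lemma analytic_meromorphic f : (forall z, analytic_at f z) -> meromorphic f.
Proof. by move=> fa z; left. Qed.

(** An analytic summand does not affect the leading coefficient at a pole. *)
Lemma meromorphicD_analytic f g : (forall z, analytic_at g z) -> meromorphic f ->
  meromorphic (fun z => g z + f z).
Proof.
move=> ga fm z; have [fa|[N [h [r [N0 ha h0 r0 fE]]]]] := fm z.
  left; have -> : (fun z => g z + f z) = (fun z => 1 * g z + f z).
    by apply: funext => w; rewrite mul1r.
  exact: (analyticZD 1 (ga z) fa).
right; exists N, (fun w => 1 * (g w * (w - z) ^+ N) + h w), r.
split; [exact: N0| | |exact: r0|].
- by apply: analyticZD ha; exact: (analyticM (ga z) (analyticX N (analytic_id z z))).
- by rewrite subrr expr0n (gtn_eqF N0) /= mulr0 mulr0 add0r.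
- move=> w wr; rewrite fE //.
  have wz : w - z != 0 by case/andP: wr => w0 _; rewrite normr_gt0 in w0.
  by field; rewrite expf_neq0.
Qed.

(** The notion of meromorphic function in use requires removable singularities to
    be filled in: at a zero of Q the value is the one which makes the quotient
    analytic, if there is one. *)
Definition fraction P Q z : C :=
  if Q z == 0 then
    xget 0 [set c | analytic_at (fun w => if w == z then c else P w / Q w) z]
  else P z / Q z.

(** By the identity theorem the zeros of Q are isolated, and at each of them the
    orders of P and Q decide between a removable singularity and a pole. *)
Lemma meromorphic_fraction P Q z0 : (forall z, analytic_at P z) ->
  (forall z, analytic_at Q z) -> Q z0 != 0 -> meromorphic (fraction P Q).
Proof.
move=> Pa Qa Q0 z.
have Qm := analytic_meromorphic Qa.
have zm : meromorphic (fun=> 0 : C).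
  by apply: analytic_meromorphic => w; exact: analytic_cst.
have Qn : punctured_near (fun w => Q w != 0) z.
  have [Qz|//] := meromorphic_dichotomy z Qm zm.
  have := identity_theorem z0 Qm zm Qz.
  move/(analytic_eq (Qa z0) (analytic_cst _ _)) => e.
  by rewrite e eqxx in Q0.
have fE : punctured_near (fun w => fraction P Q w = P w / Q w) z.
  by apply: punctured_imp Qn => w /negPf Qw; rewrite /fraction Qw.
have an H : analytic_at H z -> punctured_near (fun w => P w / Q w = H w) z ->
    analytic_at (fraction P Q) z.
  move=> Ha HE; have [Qz|Qz] := eqVneq (Q z) 0; last first.
    apply: (@analytic_ext_near _ (fun w => P w / Q w)).
      exact: (analytic_div (Pa z) (Qa z) Qz).
    have [d d0 Qd] := analytic_neq0_near (Qa z) Qz.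
    by exists d => // w /Qd /negPf Qw; rewrite /fraction Qw.
  pose F c w := if w == z then c else P w / Q w.
  have ex : exists c, analytic_at (F c) z.
    exists (H z); apply: analytic_ext_near Ha _; case: HE => r r0 HE.
    exists r => // w wr; rewrite /F; have [->//|wz] := eqVneq w z.
    by rewrite HE.
  have := @xgetPex _ 0 [set c | analytic_at (F c) z] ex.
  rewrite /= => Fa; apply: analytic_ext_near Fa _.
  case: fE => r r0 fE; exists r => // w wr; rewrite /F.
  have [->|wz] := eqVneq w z; last by rewrite fE.
  by rewrite /fraction Qz eqxx.
have [[r r0 QE]|[N [Q1 [r [r0 Q1a Q10 QE]]]]] := analytic_dichotomy (Qa z).
  have Qz : punctured_near (fun w => Q w = 0) z by exists r => // w _ /QE.
  have [w [_ _ [e]]] := punctured_inhabited (punctured_and Qz Qn) ltr01.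
  by rewrite e eqxx.
have QE' : punctured_near (fun w => Q w = (w - z) ^+ N * Q1 w) z.
  by exists r => // w _ /QE.
have Q1n : punctured_near (fun w => Q1 w != 0) z.
  by have [s s0 sQ] := analytic_neq0_near Q1a Q10; exists s => // w _ /sQ.
have [[s s0 PE]|[M [P1 [s [s0 P1a P10 PE]]]]] := analytic_dichotomy (Pa z).
  left; apply: (an (fun=> 0)); first exact: analytic_cst.
  by exists s => // w _ /PE ->; rewrite mul0r.
have PE' : punctured_near (fun w => P w = (w - z) ^+ M * P1 w) z.
  by exists s => // w _ /PE.
have F1a := analytic_div P1a Q1a Q10.
have all := punctured_and (punctured_neq z) (punctured_and Q1n (punctured_and QE' PE')).
have [NM|MN] := leqP N M.
  left; apply: (an (fun w => (w - z) ^+ (M - N) * (P1 w / Q1 w))).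
    exact: (analyticM (analyticX (M - N) (analytic_id z z)) F1a).
  apply: punctured_imp all => w [wz [Q1w [-> ->]]].
  rewrite -[in LHS](subnK NM) exprD; field.
  by rewrite Q1w expf_neq0 // subr_eq0.
right; have := punctured_and fE all; move=> [t t0 tE].
exists (N - M)%N, (fun w => P1 w / Q1 w), t; split=> //.
- by rewrite subn_gt0.
- by rewrite mulf_neq0 // invr_eq0.
move=> w; rewrite ltc_norm normr_gt0 subr_eq0 => /andP[wz wt].
have [-> [_ [Q1w [-> ->]]]] := tE w wz wt.
rewrite -[in LHS](subnK (ltnW MN)) exprD; field.
by rewrite Q1w !expf_neq0 // subr_eq0.
Qed.

End Meromorphic.

(** * The complex exponential *)

Section ComplexExponential.
Variable R : realType.
Local Notation C := R[i].
Import Normc.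
Local Open Scope complex_scope.
Implicit Types (z w : C).
Local Notation "u ~> l" := ((u : nat -> C^o) @ \oo --> (l : C^o))
  (at level 70).

Lemma normc_cexp z : normc (cexp z) = expR (complex.Re z).
Proof.
rewrite /cexp normcM normcR ger0_norm ?expR_ge0 //.
by rewrite /normc /= cos2Dsin2 sqrtr1 mulr1.
Qed.

Lemma exp_series_real (a : R) :
  (fun N => \sum_(k < N) k`!%:R^-1 * a%:C ^+ k) ~> (expR a)%:C.
Proof.
have h : series (exp_coeff a) @ \oo --> expR a by exact: is_cvg_series_exp_coeff.
have := cvgc_real h; move/cvgc_ext; apply; apply: nearW => N.
rewrite /series /= big_mkord rmorph_sum; apply: eq_bigr => k _.
by rewrite /exp_coeff /= rmorphM /= rmorphXn fmorphV rmorph_nat mulrC.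
Qed.

Lemma exp_series_imaginary (b : R) :
  (fun N => \sum_(k < N) k`!%:R^-1 * ('i%C * b%:C) ^+ k) ~> cos b +i* sin b.
Proof.
have hc : series (cos_coeff b) @ \oo --> cos b.
  by rewrite cos.unlock; exact: is_cvg_series_cos_coeff.
have hs : series (sin_coeff b) @ \oo --> sin b.
  by rewrite sin.unlock; exact: is_cvg_series_sin_coeff.
have := cvgcD (cvgc_real hc) (cvgcZ 'i%C (cvgc_real hs)).
rewrite -[X in _ ~> X -> _](complexE (cos b +i* sin b)).
move/cvgc_ext; apply; apply: nearW => N.
rewrite /series /= !big_mkord !rmorph_sum mulr_sumr -big_split.
apply: eq_bigr => k _ /=; rewrite /cos_coeff /sin_coeff /=.
have bk : (b ^+ k)%:C = b%:C ^+ k by rewrite rmorphXn.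
have sk n : ((-1) ^+ n)%:C = (-1) ^+ n :> C by rewrite rmorphXn rmorphN1.
rewrite exprMn !rmorphM /= bk !sk !fmorphV !rmorph_nat.
have -> : 'i%C ^+ k = (~~ odd k)%:R * (-1) ^+ k./2 +
    'i%C * ((odd k)%:R * (-1) ^+ k.-1./2) :> C.
  rewrite -[in LHS](odd_double_half k) exprD -mul2n exprM sqr_i.
  case: (boolP (odd k)) => ok /=; last by rewrite expr0 !mul1r mul0r mulr0 addr0.
  rewrite expr1 mul0r add0r mul1r; congr ('i%C * _ ^+ _).
  by case: {ok}(k : nat) (ok : odd k) => //= j; rewrite uphalf_half => /negPf ->.
by ring.
Qed.

(** The series of the product of the exponentials of the real and of the imaginary
    part is the Cauchy product of the two series, by the binomial theorem. The
    terms are bounded at four times the argument, which gives the ratio (1/2)^2. *)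
Lemma cexp_series z : (fun N => \sum_(k < N) k`!%:R^-1 * z ^+ k) ~> cexp z.
Proof.
have bound w l : (fun N => \sum_(k < N) k`!%:R^-1 * (4 * w) ^+ k) ~> l ->
    exists M : R, forall k, normc (k`!%:R^-1 * w ^+ k) <= M * (2^-1 ^+ 2) ^+ k.
  move=> /(@cvgc_terms_bounded _ (fun k => k`!%:R^-1 * (4 * w) ^+ k))[M [_ hM]].
  exists M => k; have := hM k.
  have -> : (2^-1 ^+ 2 : R) = 4^-1 by rewrite exprVn -natrX.
  rewrite exprVn ler_pdivlMr ?exprn_gt0 // exprMn mulrCA normcM normcX.
  have -> : normc (4 : C) = 4.
    by rewrite (_ : 4 = 4%:R%:C) ?normcR ?ger0_norm // rmorph_nat.
  by rewrite mulrC.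
pose a := complex.Re z; pose b := complex.Im z.
have [M hM] : exists M : R, forall k,
    normc (k`!%:R^-1 * a%:C ^+ k) <= M * (2^-1 ^+ 2) ^+ k.
  apply: (bound _ (expR (4 * a))%:C).
  by have := @exp_series_real (4 * a); rewrite rmorphM rmorph_nat.
have [M' hM'] : exists M : R, forall k,
    normc (k`!%:R^-1 * ('i%C * b%:C) ^+ k) <= M * (2^-1 ^+ 2) ^+ k.
  apply: (bound _ (cos (4 * b) +i* sin (4 * b))).
  by have := @exp_series_imaginary (4 * b); rewrite rmorphM rmorph_nat mulrCA.
have := cvgcB (cvgcM (@exp_series_real a) (@exp_series_imaginary b))
  (cauchy_product_cvg0 (half_range R) hM hM').
rewrite subr0 -/(cexp z); move/cvgc_ext; apply; apply: nearW => N.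
rewrite opprB addrC subrK; apply: eq_bigr => k _.
rewrite [in RHS](complexE z) -/a -/b exprDn mulr_sumr.
rewrite (reindex_inj rev_ord_inj); apply: eq_bigr => i _ /=.
have ik : (i <= k)%N by rewrite -ltnS.
rewrite subSS subKn // -mulr_natr -(bin_fact ik) !natrM.
have f0 n : n`!%:R != 0 :> C by rewrite pnatr_eq0 -lt0n fact_gt0.
by field; rewrite !f0 pnatr_eq0 -lt0n bin_gt0 ik.
Qed.

Lemma analytic_cexp (a c z0 : C) : analytic_at (fun z => cexp (a * z + c)) z0.
Proof.
exists (fun k => cexp (a * z0 + c) * (k`!%:R^-1 * a ^+ k)), 1; split=> // z _.
have := cvgcZ (cexp (a * z0 + c)) (@cexp_series (a * (z - z0))).
rewrite -cexpD (_ : a * z0 + c + a * (z - z0) = a * z + c); last by ring.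
move/cvgc_ext; apply; apply: nearW => N; rewrite mulr_sumr.
by apply: eq_bigr => k _; rewrite exprMn !mulrA.
Qed.

End ComplexExponential.

(** * Trace functions *)

Section TraceFunctions.
Variables (R : realType) (eta : R[i]).
Hypothesis heta : 0 < complex.Im eta.
Local Notation C := R[i].
Import Normc.
Local Open Scope complex_scope.
Local Notation q := (qexp eta).
Local Notation "u ~> l" := ((u : nat -> C^o) @ \oo --> (l : C^o))
  (at level 70).

Lemma normc_qexp (t : R) : normc (q t%:C) = expR (- (pi * complex.Im eta * t)).
Proof.
rewrite [q _]/(cexp _) normc_cexp; congr expR.
by case: eta => a b /=; ring.
Qed.

(** The moduli differ, because Im eta is not zero. *)
Lemma qexp_neqV n : q n.+1%:R - q (- n.+1%:R) != 0.
Proof.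
rewrite subr_eq0; apply/negP => /eqP /(congr1 (@normc R)).
have -> : n.+1%:R = (n.+1%:R : R)%:C :> C by rewrite rmorph_nat.
rewrite -rmorphN !normc_qexp => /expR_inj /eqP.
rewrite mulrN opprK -subr_eq0 -opprD oppr_eq0 -mulr2n mulrn_eq0 /=.
by rewrite !mulf_eq0 pnatr_eq0 !gt_eqF // pi_gt0.
Qed.

Lemma qexp_generic : generic q.
Proof.
move=> n; apply: mulf_neq0; first exact: qexp_neqV.
by rewrite invr_eq0; exact: (qexp_neqV 0).
Qed.

Lemma analytic_qexp a b z0 : analytic_at (fun x => q (a * x + b)) z0.
Proof.
set A := pi%:C * (0 +i* 1) * eta.
have -> : (fun x => q (a * x + b)) = (fun x => cexp (A * a * x + A * b)).
  by apply: funext => x; rewrite [LHS]/(cexp (A * _)) mulrDr mulrA.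
exact: analytic_cexp.
Qed.

Opaque qexp.

Definition entire (f : C -> C) := forall z, analytic_at f z.

Lemma entire_cst c : entire (fun=> c).
Proof. by move=> z; exact: analytic_cst. Qed.

Lemma entireM f g : entire f -> entire g -> entire (fun x => f x * g x).
Proof. by move=> fe ge z; exact: (analyticM (fe z) (ge z)). Qed.

Lemma entireD f g : entire f -> entire g -> entire (fun x => f x + g x).
Proof.
move=> fe ge z; have := analyticZD 1 (fe z) (ge z).
by under eq_fun do rewrite mul1r.
Qed.

Lemma entire_sum (I : Type) (s : seq I) (F : I -> C -> C) :
  (forall i, entire (F i)) -> entire (fun x => \sum_(i <- s) F i x).
Proof.
move=> Fe; elim: s => [|i s ih].
  have -> : (fun x => \sum_(i <- [::]) F i x) = (fun=> 0).
    by apply: funext => x; rewrite big_nil.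
  exact: entire_cst.
have -> : (fun x => \sum_(j <- i :: s) F j x) = (fun x => F i x + \sum_(j <- s) F j x).
  by apply: funext => x; rewrite big_cons.
exact: (entireD (Fe i) ih).
Qed.

Lemma entire_qexp a b : entire (fun x => q (a * x + b)).
Proof. by move=> z; exact: analytic_qexp. Qed.

Lemma entire_qexp0 a : entire (fun x => q (a * x)).
Proof. by have := entire_qexp a 0; under eq_fun do rewrite addr0. Qed.

Lemma entire_cfactor mm : entire (cfactor eta mm).
Proof.
rewrite /cfactor; apply: entireM; first exact: entire_cst.
have := entireD (entire_qexp0 1) (entireM (entire_cst (- 1)) (entire_qexp0 (- 1))).
by under eq_fun do rewrite mul1r !mulN1r.
Qed.

Lemma qpowX x k : q (x * k%:R) = q x ^+ k.
Proof.
by elim: k => [|k ih]; rewrite ?mulr0 ?qpow0 // -natr1 mulrDr mulr1 qpowD ih exprSr.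
Qed.

(** The modulus of q^(2x) is unbounded on the real axis and continuous. *)
Lemma large_region (B : R) : exists z0, punctured_near (fun x => B < normc (q (2 * x))) z0.
Proof.
have pe : 0 < pi * complex.Im eta * 2 by rewrite !mulr_gt0 // pi_gt0.
have [t Bt] : exists t : R, B + 1 < normc (q (2 * t%:C)).
  exists (- ((`|B| + 1) / (pi * complex.Im eta * 2))).
  rewrite -[2]/(2%:R) -(rmorph_nat (real_complex R)) -rmorphM normc_qexp.
  set u := (X in expR X).
  have -> : u = `|B| + 1 by rewrite /u !mulrN opprK mulrA mulrC divfK // gt_eqF.
  rewrite (le_lt_trans _ (expR_gt1Dx _)) ?gt_eqF ?ltr_wpDl //.
  by rewrite addrC lerD2l (le_trans (ler_norm B)) // lerDl.
exists t%:C; have qa := entire_qexp0 2 t%:C.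
have [d d0 hd] := analytic_continuous qa ltr01; exists d => // w _ /hd h.
have := le_normcD (q (2 * w)) (q (2 * t%:C) - q (2 * w)).
by rewrite addrC subrK normcB; lra.
Qed.

(** Each exponential gives a geometric series of ratio q^(s - 2x), which converges
    when q^(2x) is larger than q^s in modulus. The sums are put over a common
    denominator. *)
Lemma geometric_fraction (l : seq (C * C)) (c : C) :
  exists P Q (B : R), [/\ entire P, entire Q & forall x, B < normc (q (2 * x)) ->
    Q x != 0 /\
    (fun N => \sum_(k < N) (\sum_(p <- l) p.1 * q (p.2 * k%:R)) *
       q ((c - 2 * k%:R) * x)) ~> P x / Q x].
Proof.
elim: l => [|[d s] l [P [Q [B [Pe Qe h]]]]].
  exists (fun=> 0), (fun=> 1), 0; split; [exact: entire_cst|exact: entire_cst|].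
  move=> x _; split; rewrite ?oner_neq0 // mul0r.
  have := @cvgc_cst R 0; move/cvgc_ext; apply; apply: nearW => N.
  by rewrite big1 // => k _; rewrite big_nil mul0r.
pose Q1 x := 1 + - 1 * q (- 2 * x + s); pose P1 x := d * q (c * x).
have Q1e : entire Q1.
  exact: (entireD (entire_cst 1) (entireM (entire_cst (- 1)) (entire_qexp (- 2) s))).
have P1e : entire P1 by exact: (entireM (entire_cst d) (entire_qexp0 c)).
exists (fun x => P1 x * Q x + P x * Q1 x), (fun x => Q1 x * Q x),
  (Order.max B (normc (q s))).
split.
- exact: (entireD (entireM P1e Qe) (entireM Pe Q1e)).
- exact: (entireM Q1e Qe).
move=> x; rewrite gt_max => /andP[/h[Qx lx] sx].
have r1 : normc (q (- 2 * x + s)) < 1.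
  rewrite qpowD mulNr qpowN normcM normcV mulrC ltr_pdivrMr ?mul1r //.
  by rewrite normc_gt0 qpow_neq0.
have Q1x : Q1 x != 0.
  rewrite /Q1 mulN1r subr_eq0; apply: contraTneq r1 => <-.
  by rewrite normc1 ltxx.
split; first by rewrite mulf_neq0.
have -> : (P1 x * Q x + P x * Q1 x) / (Q1 x * Q x) = P1 x * (Q1 x)^-1 + P x / Q x.
  by field; rewrite Qx Q1x.
have := cvgcD (cvgcZ (P1 x) (cvgc_geometric r1)) lx.
rewrite /Q1 mulN1r; move/cvgc_ext; apply; apply: nearW => N.
rewrite mulr_sumr -big_split; apply: eq_bigr => k _ /=.
rewrite [in RHS]big_cons [in RHS]mulrDl; congr (_ + _); rewrite /P1 -qpowX.
rewrite -[in LHS]mulrA -[in RHS]mulrA -!(qpowD q) /=.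
by congr (_ * q _); ring.
Qed.

Section OneTrace.
Variables (mm : nat) (L m m' : seq nat) (lam : C).
Hypothesis summ : sumn m' = index_sum (int_weights C (zip L m)).

Lemma trace_termE x k : trace_term eta L m m' lam x k =
  PhiN_coord q (int_weights C (zip L m)) lam m' k * q ((lam - 1 - 2 * k%:R) * x).
Proof.
rewrite /trace_term VermaK.
set w := (X in PhiN _ X _); set c := q _.
have -> : PhiN q w lam (c *: << k >>) = c *: PhiN q w lam << k >>.
  by have [f ->] := linear_fun (PhiN_linear q w lam); rewrite linearZ.
by rewrite mcoeffZ mulrC /PhiN_coord summ addnK.
Qed.

(** Up to finitely many terms the trace is a combination of geometric series; its
    sum is a quotient of entire functions, hence meromorphic. *)
Lemma calF_is_calF : is_calF eta mm L m m' lam (calF eta mm L m m' lam).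
Proof.
suff ex : exists f, is_calF eta mm L m m' lam f.
  exact: (@xgetPex _ (fun=> 0) [set f | is_calF eta mm L m m' lam f] ex).
have [K [l DE]] := expsum_PhiN_coord qexp_generic (int_weights C (zip L m)) lam m'.
(* The tail of the series from rank K on, with k replaced by k + K. *)
pose l' := [seq (p.1 * q (p.2 * K%:R), p.2) | p <- l].
have [P [Q [B [Pe Qe h]]]] := geometric_fraction l' (lam - 1 - 2 * K%:R).
pose E x := \sum_(k < K) trace_term eta L m m' lam x k.
have Ee : entire E.
  apply: entire_sum => k; under eq_fun do rewrite trace_termE.
  exact: (entireM (entire_cst _) (entire_qexp0 _)).
pose P' x := cfactor eta mm x * (E x * Q x + P x).
have P'e : entire P'.
  exact: (entireM (entire_cfactor mm) (entireD (entireM Ee Qe) Pe)).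
have [z0 /punctured_inhabited /(_ _ ltr01)[z [_ _ zB]]] := large_region B.
exists (fraction P' Q); split.
  exact: (meromorphic_fraction P'e Qe (h z zB).1).
exists B => x; rewrite normCE ltcR => /h[Qx lx].
rewrite /fraction (negPf Qx).
have -> : P' x / Q x = cfactor eta mm x * (E x + P x / Q x) by rewrite /P'; field.
apply: cvgcZ; apply/(cvgc_shift K); have := cvgcD (cvgc_cst (E x)) lx.
move/cvgc_ext; apply; apply: nearW => N; rewrite addnC big_split_ord; congr (_ + _).
apply: eq_bigr => k _ /=; rewrite trace_termE DE ?leq_addr // big_map.
congr (_ * q _); last by rewrite natrD; ring.
apply: eq_bigr => p _ /=; rewrite -mulrA -qpowD natrD.
by congr (_ * q _); ring.
Qed.

End OneTrace.

Section OneEntry.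
Variables (mm lam : nat) (L m m' : seq nat).
Local Notation zs := (zip L m).
Hypothesis mL : all (fun p => p.2 <= p.1)%N zs.
Hypothesis z0 : int_weight_drop zs = 0.
Hypothesis summ : sumn m' = index_sum (int_weights C zs).

Lemma calFL_trace x : calFL eta mm L m m' lam x =
  cfactor eta mm x * \sum_(k < lam) trace_term eta L m m' lam%:R x k.
Proof.
congr (_ * _); apply: eq_bigr => k _; rewrite trace_termE //.
rewrite /qhL linextU.
have [lin _] := PhiL_is_PhiL qexp_generic lam mL z0.
have -> : forall c, PhiL q (Defs.weights R L m) (c *: << k >>) =
    c *: PhiL q (int_weights C zs) << k >>.
  move=> c; have [f e] := linear_fun lin.
  by rewrite -[PhiL _ _]/(PhiL q (int_weights C zs)) e linearZ.
rewrite mcoeffZ (PhiL_mcoeff qexp_generic) // mulrC /PhiN_coord summ addnK.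
by congr (_ * q (_ * _)); ring.
Qed.

Lemma entire_calFL : entire (calFL eta mm L m m' lam).
Proof.
have -> : calFL eta mm L m m' lam = (fun x => cfactor eta mm x *
    \sum_(k < lam) trace_term eta L m m' lam%:R x k).
  by apply: funext => x; rewrite calFL_trace.
apply: (entireM (entire_cfactor mm)).
apply: entire_sum => k; under eq_fun do rewrite trace_termE //.
exact: (entireM (entire_cst _) (entire_qexp0 _)).
Qed.

Variable m1 : seq nat.
Hypothesis m1E : zip L m1 = reflect_indices zs.
Hypothesis summ1 : sumn m' = index_sum (int_weights C (zip L m1)).

(** The weight of v^(k+lam) in M_(lam-1) is the weight of v^(k) in M_(-lam-1). *)
Lemma trace_term_shift x k : trace_term eta L m m' lam%:R x (k + lam) =
  trace_term eta L m1 m' (- lam%:R) x k.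
Proof.
rewrite !trace_termE // /PhiN_coord -summ -summ1 !addnK.
rewrite PhiN_diag_shift ?m1E //; last exact: qexp_generic.
have -> : lam%:R - 1 - 2 * (k + lam)%:R = - lam%:R - 1 - 2 * k%:R :> C.
  by rewrite natrD; ring.
by [].
Qed.

(** Where both traces converge, the terms with k < lam are the trace on the
    quotient and the others are the trace of the reflected operator. The identity
    theorem extends this to all x. *)
Lemma calF_reflection x :
  ~ has_pole (calF eta mm L m m' lam%:R) x ->
  ~ has_pole (calF eta mm L m1 m' (- lam%:R)) x ->
  calFL eta mm L m m' lam x =
  calF eta mm L m m' lam%:R x - calF eta mm L m1 m' (- lam%:R) x.
Proof.
move=> np np1; have [fm [B fB]] := calF_is_calF mm lam%:R summ.
have [gm [B' gB]] := calF_is_calF mm (- lam%:R) summ1.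
set f := calF _ _ _ m _ _ in fm fB np *; set g := calF _ _ _ m1 _ _ in gm gB np1 *.
have hm := meromorphicD_analytic entire_calFL gm.
have [y yB] := large_region (Order.max B B').
have fg : punctured_near (fun w => f w = calFL eta mm L m m' lam w + g w) y.
  apply: punctured_imp yB => w; rewrite gt_max => /andP[wB wB'].
  have fw : (fun N : nat => cfactor eta mm w *
      \sum_(k < N) trace_term eta L m m' lam%:R w k) ~> f w.
    by apply: fB; rewrite normCE ltcR.
  have gw : (fun N : nat => cfactor eta mm w *
      \sum_(k < N) trace_term eta L m1 m' (- lam%:R) w k) ~> g w.
    by apply: gB; rewrite normCE ltcR.
  apply: (cvgc_unique ((cvgc_shift lam _ _).1 fw)).
  have := cvgcD (cvgc_cst (calFL eta mm L m m' lam w)) gw.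
  move/cvgc_ext; apply; apply: nearW => N.
  rewrite calFL_trace -mulrDr; congr (_ * _).
  rewrite addnC big_split_ord; congr (_ + _); apply: eq_bigr => k _ /=.
  by rewrite addnC trace_term_shift.
have fx : analytic_at f x by case: (fm x) => [fa|/np []]; exact: fa.
have gx : analytic_at g x by case: (gm x) => [ga|/np1 []]; exact: ga.
have hx : analytic_at (fun w => calFL eta mm L m m' lam w + g w) x.
  have := analyticZD 1 (entire_calFL x) gx.
  by under eq_fun do rewrite mul1r.
by rewrite (analytic_eq fx hx (identity_theorem x fm hm fg)) addrK.
Qed.

End OneEntry.
End TraceFunctions.

(** * Admissible multi-indices and the theorem *)

Section Admissible.
Variables (R : realType) (n mm : nat) (L : n.-tuple nat).
Implicit Types m : n.-tuple nat.
Local Notation C := R[i].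

Lemma zip_tuples m : zip L m = [seq (tnth L i, tnth m i) | i <- enum 'I_n].
Proof.
by rewrite -[in LHS](map_tnth_enum L) -[in LHS](map_tnth_enum m) zip_map.
Qed.

Lemma zip_tuple_sub m : zip L (tuple_sub L m) = reflect_indices (zip L m).
Proof.
rewrite !zip_tuples /reflect_indices -map_comp; apply: eq_map => i /=.
by rewrite tnth_mktuple.
Qed.

Lemma sumn_tuple m : sumn m = (\sum_(i < n) tnth m i)%N.
Proof. by rewrite sumnE big_tuple. Qed.

Lemma index_sum_tuple m : index_sum (int_weights C (zip L m)) = sumn m.
Proof.
by rewrite /index_sum big_map zip_tuples big_map big_enum sumn_tuple.
Qed.

Lemma Adm_le m : Adm mm L m -> all (fun p => p.2 <= p.1)%N (zip L m).
Proof.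
by move=> [_ mL]; rewrite zip_tuples; apply/allP => _ /mapP[i _ ->]; exact: mL.
Qed.

Lemma Adm_sumn m : Adm mm L m -> sumn m = mm.
Proof. by move=> [s _]; rewrite sumn_tuple. Qed.

Hypothesis hL : (\sum_(i < n) tnth L i = 2 * mm)%N.

Lemma Adm_weight_drop m : Adm mm L m -> int_weight_drop (zip L m) = 0.
Proof.
move=> [s _]; rewrite /int_weight_drop zip_tuples big_map big_enum /=.
rewrite sumrB -mulr_sumr -!(rmorph_sum Posz) /= hL s PoszM subrr //.
Qed.

Lemma tuple_subK m : Adm mm L m -> tuple_sub L (tuple_sub L m) = m.
Proof.
by move=> [_ mL]; apply: eq_from_tnth => i; rewrite !tnth_mktuple subKn.
Qed.

Lemma Adm_sub m : Adm mm L m -> Adm mm L (tuple_sub L m).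
Proof.
move=> [s mL]; split=> [|i]; last by rewrite tnth_mktuple leq_subr.
under eq_bigr do rewrite tnth_mktuple.
by rewrite sumnB // hL s mul2n -addnn addnK.
Qed.

Lemma Adm_finite : finite_set (Adm mm L).
Proof.
apply: (@sub_finite_set _ _ (map_tuple (@nat_of_ord mm.+1) @` [set: n.-tuple 'I_mm.+1])).
  move=> m [s _]; exists [tuple inord (tnth m i) | i < n] => //.
  apply: eq_from_tnth => i; rewrite tnth_map tnth_mktuple inordK // ltnS -s.
  by rewrite (bigD1 i) //= leq_addr.
exact: finite_image.
Qed.

(** The Weyl reflection reindexes the sum by an involution of the admissible
    multi-indices. *)
Lemma sum_reflection (a b c : n.-tuple nat -> C) :
  (forall m, Adm mm L m -> a m = b m - c (tuple_sub L m)) ->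
  \sum_(m \in Adm mm L) a m *: << m >> =
  \sum_(m \in Adm mm L) b m *: << m >> -
  linext (fun m => << tuple_sub L m >>) (\sum_(m \in Adm mm L) c m *: << m >>)
  :> {malg C[n.-tuple nat]}.
Proof.
move=> abc; have fin := Adm_finite.
have bij : set_bij (Adm mm L) (Adm mm L) (tuple_sub L).
  split=> [m am|m1 m2|m am].
  - exact: Adm_sub.
  - rewrite !inE => am1 am2 e.
    by rewrite -(tuple_subK am1) -(tuple_subK am2) e.
  - by exists (tuple_sub L m); [exact: Adm_sub|exact: tuple_subK am].
pose V := {malg C[n.-tuple nat]}.
pose S (F : n.-tuple nat -> V) : V := \sum_(m \in Adm mm L) F m.
pose T (F : n.-tuple nat -> V) : V := \sum_(m <- fset_set (Adm mm L)) F m.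
have ST F : S F = T F by exact: fsbig_finite.
have reindex F : S F = S (F \o tuple_sub L) by exact: reindex_fsbig.
pose A m : V := a m *: << m >>; pose B m : V := b m *: << m >>.
pose D m : V := c m *: << m >>.
suff e : T A = T B - linext (fun m => << tuple_sub L m >>) (T (D \o tuple_sub L)).
  rewrite -[LHS]/(S A) -[RHS]/(S B - linext _ (S D)).
  have DE := etrans (reindex D) (ST (D \o tuple_sub L)).
  apply: (etrans (ST A)); apply: (etrans e).
  by apply: esym; apply: (congr2 (fun x y => x - linext _ y) (ST B) DE).
rewrite /T linear_sum -sumrB; apply: eq_big_seq => m; rewrite in_fset_set // inE => am.
by rewrite /A /B /D /= linearZ /= linextU (tuple_subK am) -scalerBl abc.
Qed.

End Admissible.

Lemma linext_eqB (C : fieldType) (I J : choiceType) (f g : I -> {malg C[J]})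
    (h : I -> {malg C[J]}) (s : J -> {malg C[J]}) (v : {malg C[I]}) :
  (forall i, i \in msupp v -> f i = g i - linext s (h i)) ->
  linext f v = linext g v - linext s (linext h v).
Proof.
move=> fgh; rewrite !(linextE _ v) linear_sum -sumrB.
by apply: eq_big_seq => i /fgh ->; rewrite linearZ /= -scalerBr.
Qed.

Theorem theorem7p8 (R : realType) (eta : R[i]) (heta : 0 < complex.Im eta)
    (n mm lam : nat) (hlam : (0 < lam)%N)
    (L : n.-tuple nat) (hL : (\sum_(i < n) tnth L i = 2 * mm)%N) :
  (forall x : R[i],
     (forall m m' : n.-tuple nat, Adm mm L m -> Adm mm L m' ->
        ~ has_pole (calF eta mm L m m' lam%:R) x /\
        ~ has_pole (calF eta mm L m m' (- lam%:R)) x) ->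
     forall v : {malg R[i][n.-tuple nat]}, in_zero_weight mm L v ->
       calFL_map eta mm L lam x v =
         calF_map eta mm L lam%:R x v -
         weyl L (fun l => calF_map eta mm L l x v) lam%:R) /\
  (forall m m' : n.-tuple nat, Adm mm L m -> Adm mm L m' ->
     forall x : R[i],
       ~ has_pole (calF eta mm L m m' lam%:R) x ->
       ~ has_pole (calF eta mm L (tuple_sub L m) m' (- lam%:R)) x ->
       calFL eta mm L m m' lam x =
         calF eta mm L m m' lam%:R x -
         calF eta mm L (tuple_sub L m) m' (- lam%:R) x).
Proof.
have entries m m' : Adm mm L m -> Adm mm L m' -> forall x : R[i],
    ~ has_pole (calF eta mm L m m' lam%:R) x ->
    ~ has_pole (calF eta mm L (tuple_sub L m) m' (- lam%:R)) x ->
    calFL eta mm L m m' lam x = calF eta mm L m m' lam%:R x -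
      calF eta mm L (tuple_sub L m) m' (- lam%:R) x.
  move=> am am' x; apply: (calF_reflection heta).
  - exact: Adm_le am.
  - exact: (Adm_weight_drop hL am).
  - by rewrite (index_sum_tuple R) (Adm_sumn am) (Adm_sumn am').
  - exact: zip_tuple_sub.
  - by rewrite (index_sum_tuple R) (Adm_sumn am') (Adm_sumn (Adm_sub hL am)).
split=> // x np v v0.
apply: linext_eqB => m' m'v.
have am' : Adm mm L m' by apply: v0; rewrite mcoeff_neq0.
apply: (sum_reflection hL) => m am; apply: entries => //.
  by have [] := np m m' am am'.
by have [] := np (tuple_sub L m) m' (Adm_sub hL am) am'.
Qed.
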